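(* Let $n\ge 1$ be an integer, let $k$ be an odd integer with $1\le k\le n$, let $a>0$ and let $\alpha,\beta\in\mathbb{R}$. Assume that $$\alpha\le \frac{\beta(n-2k)}{k}\quad\text{and}\quad \beta>0 .$$ Then there exists a unique solution $v$ on $(0,\infty)$ of $$c_{n,k}\,r^{1-n}\bigl(r^{n-k}(v'(r))^k\bigr)'+\alpha v(r)+\beta r v'(r)=0,\qquad v(r)>0,\qquad r\in(0,\infty),$$ satisfying $v(0)=a$ and $v'(0)=0$. Moreover, if $\alpha\ne 0$ and $\delta=\beta/\alpha$, then the function $E(r)=r^2 v(r)^{2\delta}$ satisfies $E'(r)>0$ for all $r>0$.
   Context: Here $c_{n,k}=\frac1n\binom{n}{k}$, and prime denotes differentiation with respect to $r$. A solution on $(0,R)$, $0<R\le\infty$, of the initial value problem means a function $v\in C^1([0,R))\cap C^2((0,R))$ that is positive, satisfies the differential equation pointwise on $(0,R)$, and satisfies $v(0)=a$, $v'(0)=0$. The equation is the radial form ($r=|\xi|$) of $S_k(D^2v)+\alpha v+\beta\,\xi\cdot\nabla v=0$, $v>0$ in $\mathbb{R}^n$, where $S_k(D^2 v)$ is the $k$-Hessian operator, i.e. the $k$-th elementary symmetric function of the eigenvalues of the Hessian $D^2v$. *)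

(* Defs.v *)
From Stdlib Require Import Reals Arith ZArith.
From Coquelicot Require Import Coquelicot.

Open Scope R_scope.

(* The intervals [0, T) and (0, T), with T possibly +oo. *)
Definition Ico0 (T : Rbar) (r : R) : Prop := 0 <= r /\ Rbar_lt r T.
Definition Ioo0 (T : Rbar) (r : R) : Prop := 0 < r /\ Rbar_lt r T.

(* Derivative relative to D, one-sided at an endpoint belonging to D.
   With D replaced by the whole line this is Coquelicot's is_derive. *)
Definition is_derive_on (D : R -> Prop) (f : R -> R) (x l : R) : Prop :=
  filterdiff f (within D (locally x)) (fun h : R => scal h l).

Definition C1_on (D : R -> Prop) (f : R -> R) : Prop :=
  exists f' : R -> R,
    (forall x, D x -> is_derive_on D f x (f' x)) /\ continuous_on D f'.

Definition C2_on (D : R -> Prop) (f : R -> R) : Prop :=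
  exists f' : R -> R,
    (forall x, D x -> is_derive_on D f x (f' x)) /\ C1_on D f'.

(* Binomial.C is qualified because Coquelicot uses C for the complex numbers. *)
Definition c_coef (n k : nat) : R := / INR n * Binomial.C n k.

Definition radial_lhs (n k : nat) (alpha beta : R) (v : R -> R) (r : R) : R :=
  c_coef n k * powerRZ r (1 - Z.of_nat n)
    * Derive (fun s => s ^ (n - k) * (Derive v s) ^ k) r
  + alpha * v r + beta * r * Derive v r.

(* The values of v outside [0, T) are irrelevant.  The equation involves only
   points of the open interval (0, T), where v is C^2 in the usual sense, so the
   total operator Derive is meaningful there; the condition v'(0) = 0 is about
   the one-sided derivative. *)
Definition is_solution (n k : nat) (alpha beta a : R) (T : Rbar)
    (v : R -> R) : Prop :=
  C1_on (Ico0 T) v /\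
  C2_on (Ioo0 T) v /\
  (forall r, Ioo0 T r -> 0 < v r) /\
  (forall r, Ioo0 T r -> radial_lhs n k alpha beta v r = 0) /\
  v 0 = a /\
  is_derive_on (Ico0 T) v 0 0.

(* Main.v *)
Require Import Defs.
From Stdlib Require Import Reals Arith ZArith Lra Lia ClassicalEpsilon.
From Coquelicot Require Import Coquelicot.

Open Scope R_scope.

(** Write c for the coefficient c_(n,k) and n = m + 1.

    Since k is odd, the equation is invariant under v -> - v.  For alpha <> 0
    it is therefore enough to study u = sgn(alpha) v, for which
    alpha u(0) > 0; this treats both signs of alpha at once, and u turns out to
    be decreasing.

    Multiplying the equation by r^(n-1) and integrating gives the first integral
      c r^(n-k) u'(r)^k = - r^n Phi(r),
      Phi(r) = beta u(r) + (alpha - n beta) int_0^1 t^(n-1) u(r t) dt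
    ([first_integral]).  Here Phi(0) = alpha u(0) / n > 0, and as long as Phi is
    positive the identity reads u' = - r (Phi / c)^(1/k).  The singularity at
    r = 0 has disappeared: this is a Volterra equation for u whose nonlinearity
    is Lipschitz wherever Phi is bounded away from 0.  With the root truncated
    below a level eta > 0, the Picard operator halves distances in the sup norm
    with weight exp(- lam r^2), so the truncated problem has one global solution
    ([volterra_exists], [volterra_unique]).

    The heart of the proof is an a priori bound that makes the truncation
    harmless.  With p = (Phi / c)^(1/k) = - u'/r, the function
    X = alpha u + beta r u' satisfies
      X' = r p (beta n / k - 2 beta - alpha) - (beta r p / (k Phi)) X,
    and the assumption on alpha says exactly that the first term is nonnegative;
    as X(0) = alpha u(0) > 0, X stays positive ([slope_excess_pos]).  But
    (r^n Phi)' = r^(n-1) X, so r^n Phi is nondecreasing ([flux_growth]).  Hence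
    Phi never reaches 0, and a lower bound for Phi near the origin yields one on
    every interval [0, R], known before the solution is: truncating below it
    gives a solution of the original problem on [0, R], and these solutions
    agree with each other and fit together ([profile_exists]).  The same argument
    shows that Phi > 0 for every solution, so that every solution satisfies the
    Volterra equation, and uniqueness follows ([solution_unique]).

    Everything else is read off from X > 0 and u' < 0.  Since beta > 0,
    alpha u > - beta r u' > 0, which is the positivity of v = sgn(alpha) u; and
    E' = 2 r v^(2 delta - 1) (v + delta r v') with
    v + delta r v' = X / |alpha| > 0.

    For alpha = 0 the constant a is a solution.  It is the only one because
    y = r^(n-k) v'^k satisfies (y^2)' <= 0 and y(0) = 0
    ([solution_constant]). *)

(** * Averages over balls *)

(** The average int_0^1 t^m f(r t) dt instead of r^(-m-1) int_0^r s^m f(s) ds: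
    the two agree for r <> 0 ([mean_scaled]), and this form has no singularity at
    the origin. *)
Definition mean (m : nat) (f : R -> R) (r : R) : R :=
  RInt (fun t => t ^ m * f (r * t)) 0 1.

(** For [kap = alpha - (m + 1) beta] this is the function Phi of the introduction:
    r^(m+1) Phi(r) is the integral of s^m (alpha f + beta s f') over [0, r],
    written without the derivative of f. *)
Definition flux (m : nat) (kap beta : R) (f : R -> R) (r : R) : R :=
  beta * f r + kap * mean m f r.

Lemma continuous_Rmult (f g : R -> R) (x : R) :
  continuous f x -> continuous g x -> continuous (fun y => f y * g y) x.
Proof. intros Hf Hg. exact (continuous_mult f g x Hf Hg). Qed.

Lemma continuous_Rplus (f g : R -> R) (x : R) :
  continuous f x -> continuous g x -> continuous (fun y => f y + g y) x.
Proof. intros Hf Hg. exact (continuous_plus f g x Hf Hg). Qed.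

Lemma continuous_Rabs_all (x : R) : continuous Rabs x.
Proof.
  apply continuity_pt_filterlim, Rcontinuity_abs.
Qed.

Lemma continuous_pow_all (m : nat) (x : R) : continuous (fun y => y ^ m) x.
Proof.
  apply continuity_pt_filterlim, derivable_continuous_pt, derivable_pt_pow.
Qed.

Lemma ex_RInt_continuous_all (f : R -> R) (a b : R) :
  (forall x, continuous f x) -> ex_RInt f a b.
Proof.
  intros Hf. apply (ex_RInt_continuous (V := R_CompleteNormedModule)).
  intros x _. apply Hf.
Qed.

Lemma is_derive_RInt_all (f : R -> R) (a x : R) :
  (forall y, continuous f y) -> is_derive (fun y => RInt f a y) x (f x).
Proof.
  intros Hf. apply (is_derive_RInt f _ a); [| apply Hf].
  apply filter_forall. intros y. apply (RInt_correct (V := R_CompleteNormedModule)).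
  now apply ex_RInt_continuous_all.
Qed.

Lemma continuous_mean_integrand (m : nat) (f : R -> R) (r t : R) :
  (forall x, continuous f x) -> continuous (fun t => t ^ m * f (r * t)) t.
Proof.
  intros Hf. apply continuous_Rmult; [apply continuous_pow_all |].
  apply (continuous_comp (fun t => r * t) f); [| apply Hf].
  apply continuous_Rmult; [apply continuous_const | apply continuous_id].
Qed.

Lemma ex_RInt_mean (m : nat) (f : R -> R) (r a b : R) :
  (forall x, continuous f x) -> ex_RInt (fun t => t ^ m * f (r * t)) a b.
Proof.
  intros Hf. apply ex_RInt_continuous_all. intros t.
  now apply continuous_mean_integrand.
Qed.

(** The weights t^m are at most 1 on the unit interval, so averaging does not
    increase distances. *)
Lemma mean_diff_le (m : nat) (f1 f2 : R -> R) (r1 r2 M : R) :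
  (forall x, continuous f1 x) -> (forall x, continuous f2 x) ->
  (forall t, 0 <= t <= 1 -> Rabs (f1 (r1 * t) - f2 (r2 * t)) <= M) ->
  Rabs (mean m f1 r1 - mean m f2 r2) <= M.
Proof.
  intros H1 H2 HM. unfold mean.
  assert (HM0 : 0 <= M).
  { apply Rle_trans with (2 := HM 0 ltac:(lra)). apply Rabs_pos. }
  assert (E1 := ex_RInt_mean m f1 r1 0 1 H1).
  assert (E2 := ex_RInt_mean m f2 r2 0 1 H2).
  change (Rabs (minus (RInt (fun t => t ^ m * f1 (r1 * t)) 0 1)
    (RInt (fun t => t ^ m * f2 (r2 * t)) 0 1)) <= M).
  rewrite <- (RInt_minus (V := R_CompleteNormedModule) _ _ _ _ E1 E2).
  replace M with ((1 - 0) * M) by ring.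
  apply (abs_RInt_le_const _ 0 1 M); [lra | now apply @ex_RInt_minus |].
  intros t Ht. unfold minus, plus, opp; simpl.
  replace (t ^ m * f1 (r1 * t) + - (t ^ m * f2 (r2 * t)))
    with (t ^ m * (f1 (r1 * t) - f2 (r2 * t))) by ring.
  rewrite Rabs_mult, <- (Rmult_1_l M).
  apply Rmult_le_compat; try apply Rabs_pos; [| now apply HM].
  rewrite Rabs_pos_eq by (apply pow_le; lra).
  rewrite <- (pow1 m). apply pow_incr. lra.
Qed.

(** Uniform continuity of f on a compact neighbourhood of [- |r|, |r|] carries
    over to the average. *)
Lemma continuous_mean (m : nat) (f : R -> R) (r : R) :
  (forall x, continuous f x) -> continuous (mean m f) r.
Proof.
  intros Hf. apply continuity_pt_filterlim.
  apply continuity_pt_locally. intros eps.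
  assert (Hf' : forall x, - (Rabs r + 1) <= x <= Rabs r + 1 -> continuity_pt f x).
  { intros x _. apply continuity_pt_filterlim, Hf. }
  destruct (Heine_cor2 Hf' (mkposreal _ (is_pos_div_2 eps))) as [d Hd].
  simpl in Hd.
  assert (Hmin : 0 < Rmin d 1) by (apply Rmin_pos; [apply cond_pos | lra]).
  exists (mkposreal _ Hmin). intros y Hy.
  change (Rabs (y - r) < Rmin d 1) in Hy.
  assert (Hy1 := Rlt_le_trans _ _ _ Hy (Rmin_l _ _)).
  assert (Hy2 := Rlt_le_trans _ _ _ Hy (Rmin_r _ _)).
  apply Rle_lt_trans with (eps / 2); [| generalize (cond_pos eps); lra].
  apply mean_diff_le; trivial.
  intros t Ht. apply Rlt_le, Hd.
  - assert (H : Rabs (y * t) <= Rabs r + 1).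
    { rewrite Rabs_mult, (Rabs_pos_eq t) by lra.
      assert (Rabs y <= Rabs r + 1).
      { replace y with ((y - r) + r) by ring.
        eapply Rle_trans; [apply Rabs_triang | lra]. }
      generalize (Rabs_pos y); nra. }
    now apply Rabs_le_between.
  - assert (H : Rabs (r * t) <= Rabs r + 1).
    { rewrite Rabs_mult, (Rabs_pos_eq t) by lra.
      generalize (Rabs_pos r); nra. }
    now apply Rabs_le_between.
  - replace (y * t - r * t) with ((y - r) * t) by ring.
    rewrite Rabs_mult, (Rabs_pos_eq t) by lra.
    generalize (Rabs_pos (y - r)); nra.
Qed.

Lemma mean_0 (m : nat) (f : R -> R) : mean m f 0 = f 0 / INR (S m).
Proof.
  unfold mean.
  rewrite (RInt_ext _ (fun t => f 0 * t ^ m)).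
  2:{ intros t Ht. cbn beta. rewrite Rmult_0_l. rewrite Rmult_comm. reflexivity. }
  apply is_RInt_unique.
  assert (HS : INR (S m) <> 0) by (apply not_0_INR; lia).
  assert (HD : is_RInt (fun t => f 0 * t ^ m) 0 1
    (minus (f 0 * (1 ^ S m / INR (S m))) (f 0 * (0 ^ S m / INR (S m))))).
  { apply (is_RInt_derive (fun t => f 0 * (t ^ S m / INR (S m)))
      (fun t => f 0 * t ^ m)).
    - intros t _. auto_derive; trivial.
      change (f 0 * (1 * (INR (S m) * t ^ m) * / INR (S m)) = f 0 * t ^ m).
      now field.
    - intros t _.
      apply continuous_Rmult; [apply continuous_const | apply continuous_pow_all]. }
  replace (f 0 / INR (S m)) with
    (minus (f 0 * (1 ^ S m / INR (S m))) (f 0 * (0 ^ S m / INR (S m)))); [exact HD |].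
  change (f 0 * (1 ^ S m / INR (S m)) - f 0 * (0 ^ S m / INR (S m))
    = f 0 / INR (S m)).
  rewrite pow1, pow_i by lia. now field.
Qed.

Lemma mean_scaled (m : nat) (f : R -> R) (r : R) :
  (forall x, continuous f x) ->
  r ^ S m * mean m f r = RInt (fun s => s ^ m * f s) 0 r.
Proof.
  intros Hf. unfold mean.
  assert (Hc : forall x, continuous (fun s => s ^ m * f s) x).
  { intros x. apply continuous_Rmult; [apply continuous_pow_all | apply Hf]. }
  assert (H := RInt_comp_lin (fun s => s ^ m * f s) r 0 0 1
    (ex_RInt_continuous_all _ _ _ Hc)).
  replace (r * 0 + 0) with 0 in H by ring.
  replace (r * 1 + 0) with r in H by ring.
  rewrite <- H.
  change (scal (r ^ S m) (RInt (V := R_CompleteNormedModule)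
      (fun t => t ^ m * f (r * t)) 0 1)
    = RInt (fun t => r * ((r * t + 0) ^ m * f (r * t + 0))) 0 1).
  rewrite <- (RInt_scal (V := R_CompleteNormedModule) _ 0 1 _
    (ex_RInt_mean m f r 0 1 Hf)).
  apply RInt_ext. intros t _. unfold scal; simpl; unfold mult; simpl.
  rewrite Rplus_0_r, Rpow_mult_distr. ring.
Qed.

Lemma is_derive_mean (m : nat) (f : R -> R) (r : R) :
  (forall x, continuous f x) -> 0 < r ->
  is_derive (mean m f) r ((f r - INR (S m) * mean m f r) / r).
Proof.
  intros Hf Hr.
  assert (Hc : forall x, continuous (fun s => s ^ m * f s) x).
  { intros x. apply continuous_Rmult; [apply continuous_pow_all | apply Hf]. }
  apply (is_derive_ext_loc (fun x => RInt (fun s => s ^ m * f s) 0 x / x ^ S m)).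
  { exists (mkposreal r Hr). intros y Hy.
    change (Rabs (y - r) < r) in Hy. apply Rabs_lt_between in Hy.
    rewrite <- mean_scaled by trivial.
    change (@eq R (y ^ S m * mean m f y / y ^ S m) (mean m f y)).
    field. apply pow_nonzero. lra. }
  assert (HD := is_derive_RInt_all _ 0 r Hc).
  assert (Hrm : r ^ m <> 0) by (apply pow_nonzero; lra).
  assert (Hrm1 : r ^ S m <> 0) by (apply pow_nonzero; lra).
  assert (HP : is_derive (fun x : R => x ^ S m) r (INR (S m) * r ^ m)).
  { auto_derive; trivial. change (1 * (INR (S m) * r ^ m) = INR (S m) * r ^ m). ring. }
  assert (H := is_derive_div _ _ _ _ _ HD HP Hrm1).
  replace ((f r - INR (S m) * mean m f r) / r)
    with ((r ^ m * f r * r ^ S m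
           - RInt (fun s => s ^ m * f s) 0 r * (INR (S m) * r ^ m))
          / (r ^ S m) ^ 2); [exact H |].
  rewrite <- mean_scaled by trivial. rewrite <- tech_pow_Rmult. field. lra.
Qed.

(** * The Volterra operator *)

Lemma continuous_flux (m : nat) (kap beta : R) (f : R -> R) (r : R) :
  (forall x, continuous f x) -> continuous (flux m kap beta f) r.
Proof.
  intros Hf. apply continuous_Rplus; apply continuous_Rmult;
    try apply continuous_const; [apply Hf | now apply continuous_mean].
Qed.

Lemma flux_diff_le (m : nat) (kap beta : R) (f1 f2 : R -> R) (r M : R) :
  (forall x, continuous f1 x) -> (forall x, continuous f2 x) -> 0 <= r ->
  (forall s, 0 <= s <= r -> Rabs (f1 s - f2 s) <= M) ->
  Rabs (flux m kap beta f1 r - flux m kap beta f2 r)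
    <= (Rabs beta + Rabs kap) * M.
Proof.
  intros H1 H2 Hr HM. unfold flux.
  replace (beta * f1 r + kap * mean m f1 r - (beta * f2 r + kap * mean m f2 r))
    with (beta * (f1 r - f2 r) + kap * (mean m f1 r - mean m f2 r)) by ring.
  eapply Rle_trans; [apply Rabs_triang |]. rewrite !Rabs_mult.
  rewrite Rmult_plus_distr_r.
  apply Rplus_le_compat; apply Rmult_le_compat_l; try apply Rabs_pos.
  - apply HM. lra.
  - apply mean_diff_le; trivial. intros t Ht. apply HM. nra.
Qed.

Lemma flux_ext (m : nat) (kap beta : R) (f1 f2 : R -> R) (r : R) :
  (forall x, continuous f1 x) -> (forall x, continuous f2 x) -> 0 <= r ->
  (forall s, 0 <= s <= r -> f1 s = f2 s) ->
  flux m kap beta f1 r = flux m kap beta f2 r.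
Proof.
  intros H1 H2 Hr H. apply Rminus_diag_uniq.
  assert (HD := flux_diff_le m kap beta f1 f2 r 0 H1 H2 Hr).
  rewrite Rmult_0_r in HD. apply Rabs_eq_0, Rle_antisym; [| apply Rabs_pos].
  apply HD. intros s Hs. rewrite (H s Hs), Rminus_diag, Rabs_R0. apply Rle_refl.
Qed.

Lemma flux_0 (m : nat) (alpha beta : R) (f : R -> R) :
  flux m (alpha - INR (S m) * beta) beta f 0 = alpha * f 0 / INR (S m).
Proof.
  unfold flux. rewrite mean_0. field. apply not_0_INR. lia.
Qed.

(** A fixed point has the derivative - r g(Phi(r)) for r > 0 and the value b
    at 0.  The absolute value makes the operator act on functions on the whole
    line, which keeps derivatives at 0 two-sided while only values on the
    half-line matter. *)
Definition volterra (m : nat) (kap beta b : R) (g f : R -> R) (r : R) : R :=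
  b - RInt (fun s => s * g (flux m kap beta f (Rabs s))) 0 r.

Lemma continuous_volterra_integrand
    (m : nat) (kap beta : R) (g f : R -> R) (s : R) :
  (forall x, continuous f x) ->
  (forall x, 0 <= x -> continuous g (flux m kap beta f x)) ->
  continuous (fun s => s * g (flux m kap beta f (Rabs s))) s.
Proof.
  intros Hf Hg. apply continuous_Rmult; [apply continuous_id |].
  apply (continuous_comp (fun s => flux m kap beta f (Rabs s)) g).
  - apply (continuous_comp Rabs); [apply continuous_Rabs_all |].
    now apply continuous_flux.
  - apply Hg, Rabs_pos.
Qed.

Lemma is_derive_volterra (m : nat) (kap beta b : R) (g f : R -> R) (r : R) :
  (forall x, continuous f x) ->
  (forall x, 0 <= x -> continuous g (flux m kap beta f x)) ->
  is_derive (volterra m kap beta b g f) r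
    (- (r * g (flux m kap beta f (Rabs r)))).
Proof.
  intros Hf Hg. unfold volterra.
  assert (H := is_derive_RInt_all _ 0 r
    (fun s => continuous_volterra_integrand m kap beta g f s Hf Hg)).
  evar_last.
  - apply (is_derive_minus (fun _ => b)); [apply is_derive_const | exact H].
  - unfold minus, plus, opp, zero; simpl. ring.
Qed.

Lemma continuous_volterra (m : nat) (kap beta b : R) (g f : R -> R) (r : R) :
  (forall x, continuous f x) ->
  (forall x, 0 <= x -> continuous g (flux m kap beta f x)) ->
  continuous (volterra m kap beta b g f) r.
Proof.
  intros Hf Hg. apply (ex_derive_continuous (V := R_NormedModule)).
  eexists. now apply is_derive_volterra.
Qed.

(** The operator is causal: its value at r depends on f only through [0, r]. *)
Lemma volterra_ext (m : nat) (kap beta b : R) (g1 g2 f1 f2 : R -> R) (r : R) :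
  (forall x, continuous f1 x) -> (forall x, continuous f2 x) -> 0 <= r ->
  (forall s, 0 <= s <= r -> f1 s = f2 s) ->
  (forall s, 0 <= s <= r ->
     g1 (flux m kap beta f1 s) = g2 (flux m kap beta f1 s)) ->
  volterra m kap beta b g1 f1 r = volterra m kap beta b g2 f2 r.
Proof.
  intros H1 H2 Hr Hf Hg. unfold volterra. f_equal.
  apply RInt_ext. intros s. rewrite Rmin_left, Rmax_right by lra. intros Hs.
  rewrite Rabs_pos_eq by lra. rewrite Hg by lra.
  rewrite (flux_ext m kap beta f1 f2) by
    (trivial; try lra; intros; apply Hf; lra).
  reflexivity.
Qed.

(** The factor s in the Volterra kernel makes exp(lam s^2) the convenient weight:
    integrating gains 1 / (2 lam). *)
Lemma is_RInt_gauss (lam r : R) : 0 < lam ->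
  is_RInt (fun s => s * exp (lam * s ^ 2)) 0 r
    ((exp (lam * r ^ 2) - 1) / (2 * lam)).
Proof.
  intros Hl.
  replace ((exp (lam * r ^ 2) - 1) / (2 * lam))
    with (minus (exp (lam * r ^ 2) / (2 * lam)) (exp (lam * 0 ^ 2) / (2 * lam))).
  2:{ replace (lam * 0 ^ 2) with 0 by ring. rewrite exp_0.
      change (exp (lam * r ^ 2) / (2 * lam) - 1 / (2 * lam)
        = (exp (lam * r ^ 2) - 1) / (2 * lam)).
      field. lra. }
  apply (is_RInt_derive (fun s => exp (lam * s ^ 2) / (2 * lam))).
  - intros s _. auto_derive; trivial. change (s * (s * 1)) with (s ^ 2). field. lra.
  - intros s _. apply (ex_derive_continuous (V := R_NormedModule)).
    auto_derive. trivial.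
Qed.

(** * Contraction in a weighted norm *)

Section Contraction.

Context (m : nat) (kap beta b L : R) (g : R -> R).
Context (HL : 0 <= L).
Context (Hg : forall x y, Rabs (g x - g y) <= L * Rabs (x - y)).

Local Notation lam := (L * (Rabs beta + Rabs kap) + 1).
Local Notation T := (volterra m kap beta b g).

Lemma lipschitz_continuous (x : R) : continuous g x.
Proof.
  apply continuity_pt_filterlim, continuity_pt_locally. intros eps.
  assert (Hd : 0 < eps / (L + 1)).
  { apply Rdiv_lt_0_compat; [apply cond_pos | lra]. }
  exists (mkposreal _ Hd). intros y Hy. change (Rabs (y - x) < eps / (L + 1)) in Hy.
  apply Rle_lt_trans with (1 := Hg y x).
  apply Rle_lt_trans with ((L + 1) * Rabs (y - x)).
  - generalize (Rabs_pos (y - x)). nra.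
  - apply Rmult_lt_reg_r with (/ (L + 1)); [apply Rinv_0_lt_compat; lra |].
    replace ((L + 1) * Rabs (y - x) * / (L + 1)) with (Rabs (y - x)) by (field; lra).
    exact Hy.
Qed.

Lemma weight_pos : 0 < lam.
Proof.
  generalize (Rabs_pos beta), (Rabs_pos kap). nra.
Qed.

Lemma weight_le (s r : R) : 0 <= s <= r -> exp (lam * s ^ 2) <= exp (lam * r ^ 2).
Proof.
  intros H. destruct (Req_dec s r) as [-> | Hn]; [apply Rle_refl |].
  apply Rlt_le, exp_increasing, Rmult_lt_compat_l; [apply weight_pos | nra].
Qed.

(** In the norm sup |f(s)| exp(- lam s^2) the operator has Lipschitz constant at
    most L (|beta| + |kap|) / (2 lam), which is below 1/2 for the chosen lam,
    on intervals of any length. *)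
Lemma volterra_contract (f1 f2 : R -> R) (r M : R) :
  (forall x, continuous f1 x) -> (forall x, continuous f2 x) -> 0 <= r ->
  (forall s, 0 <= s <= r -> Rabs (f1 s - f2 s) <= M * exp (lam * s ^ 2)) ->
  Rabs (T f1 r - T f2 r) <= M / 2 * exp (lam * r ^ 2).
Proof.
  intros H1 H2 Hr HM.
  assert (Hlam := weight_pos).
  set (l := lam) in *.
  assert (HM0 : 0 <= M).
  { assert (H := HM 0 ltac:(lra)). replace (l * 0 ^ 2) with 0 in H by ring.
    rewrite exp_0 in H. generalize (Rabs_pos (f1 0 - f2 0)). lra. }
  set (K := Rabs beta + Rabs kap) in *.
  assert (HK : 0 <= K).
  { unfold K. generalize (Rabs_pos beta), (Rabs_pos kap). lra. }
  pose (F := fun f s => s * g (flux m kap beta f (Rabs s))).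
  assert (HF : forall f, (forall x, continuous f x) ->
    is_RInt (F f) 0 r (RInt (F f) 0 r)).
  { intros f Hf. apply (RInt_correct (V := R_CompleteNormedModule)).
    apply ex_RInt_continuous_all. intros s.
    apply continuous_volterra_integrand; trivial.
    intros x _. apply lipschitz_continuous. }
  replace (T f1 r - T f2 r) with (RInt (F f2) 0 r - RInt (F f1) 0 r)
    by (unfold volterra, F; ring).
  apply Rle_trans with (L * K * M * ((exp (l * r ^ 2) - 1) / (2 * l))).
  - apply (norm_RInt_le (V := R_NormedModule) (fun s => minus (F f2 s) (F f1 s))
      (fun s => L * K * M * (s * exp (l * s ^ 2))) 0 r
      (minus (RInt (F f2) 0 r) (RInt (F f1) 0 r))); trivial.
    + intros s Hs.
      change (Rabs (F f2 s - F f1 s) <= L * K * M * (s * exp (l * s ^ 2))).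
      unfold F. rewrite (Rabs_pos_eq s) by lra. rewrite <- Rmult_minus_distr_l.
      rewrite Rabs_mult, (Rabs_pos_eq s) by lra.
      replace (L * K * M * (s * exp (l * s ^ 2)))
        with (s * (L * (K * (M * exp (l * s ^ 2))))) by ring.
      apply Rmult_le_compat_l; [lra |].
      apply Rle_trans with (1 := Hg _ _). apply Rmult_le_compat_l; [exact HL |].
      apply flux_diff_le; trivial; [lra |].
      intros t Ht. rewrite Rabs_minus_sym. apply Rle_trans with (1 := HM t ltac:(lra)).
      apply Rmult_le_compat_l; trivial. now apply weight_le.
    + apply @is_RInt_minus; now apply HF.
    + apply (is_RInt_scal (V := R_NormedModule)). now apply is_RInt_gauss.
  - set (W := exp (l * r ^ 2)).
    assert (HW : 0 < W) by apply exp_pos.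
    assert (HX : 0 <= L * K * M) by (apply Rmult_le_pos; trivial; now apply Rmult_le_pos).
    apply Rmult_le_reg_r with (2 * l); [lra |].
    replace (L * K * M * ((W - 1) / (2 * l)) * (2 * l))
      with (L * K * M * (W - 1)) by (field; lra).
    replace (M / 2 * W * (2 * l)) with (l * M * W) by field.
    apply Rle_trans with (L * K * M * W); [nra |].
    apply Rmult_le_compat_r; [lra |].
    unfold l; fold K. nra.
Qed.

Lemma continuous_volterra_lipschitz (f : R -> R) (r : R) :
  (forall x, continuous f x) -> continuous (T f) r.
Proof.
  intros Hf. apply continuous_volterra; trivial.
  intros x _. apply lipschitz_continuous.
Qed.

Lemma nonpos_of_le_halving (x C : R) : (forall j, x <= C * (1 / 2) ^ j) -> x <= 0.
Proof.
  intros H. apply Rnot_lt_le. intros Hx.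
  assert (HC : 0 < C) by (generalize (H 0%nat); simpl; lra).
  destruct (pow_lt_1_zero (1 / 2) ltac:(rewrite Rabs_pos_eq; lra) (x / C)
    ltac:(now apply Rdiv_lt_0_compat)) as [N HN].
  assert (HN' := HN N (le_n N)).
  rewrite Rabs_pos_eq in HN' by (apply pow_le; lra).
  apply (Rmult_lt_compat_l C) in HN'; trivial.
  replace (C * (x / C)) with x in HN' by (field; lra).
  generalize (H N). lra.
Qed.

Lemma volterra_unique (f1 f2 : R -> R) (R0 : R) :
  (forall x, continuous f1 x) -> (forall x, continuous f2 x) ->
  (forall r, 0 <= r <= R0 -> f1 r = T f1 r) ->
  (forall r, 0 <= r <= R0 -> f2 r = T f2 r) ->
  forall r, 0 <= r <= R0 -> f1 r = f2 r.
Proof.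
  intros H1 H2 E1 E2 r Hr.
  assert (Hc : forall s, 0 <= s <= R0 -> continuity_pt (fun s => Rabs (f1 s - f2 s)) s).
  { intros s _. apply continuity_pt_filterlim.
    apply (continuous_comp (fun s => f1 s - f2 s) Rabs);
      [| apply continuous_Rabs_all].
    now apply (continuous_minus f1 f2). }
  destruct (continuity_ab_maj _ 0 R0 ltac:(lra) Hc) as [x0 [Hx0 _]].
  set (M := Rabs (f1 x0 - f2 x0)) in *.
  assert (HM : 0 <= M) by apply Rabs_pos.
  assert (Hj : forall j s, 0 <= s <= R0 ->
    Rabs (f1 s - f2 s) <= M * (1 / 2) ^ j * exp (lam * s ^ 2)).
  { induction j as [| j IH]; intros s Hs.
    - rewrite pow_O, Rmult_1_r. apply Rle_trans with (1 := Hx0 s Hs).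
      assert (1 <= exp (lam * s ^ 2)); [| nra].
      assert (Hw := weight_le 0 s ltac:(lra)).
      replace (lam * 0 ^ 2) with 0 in Hw by ring. now rewrite exp_0 in Hw.
    - rewrite E1, E2 by trivial.
      replace (M * (1 / 2) ^ S j) with (M * (1 / 2) ^ j / 2) by (simpl; field).
      apply volterra_contract; trivial; [lra |].
      intros t Ht. apply IH. lra. }
  apply Rminus_diag_uniq, Rabs_eq_0, Rle_antisym; [| apply Rabs_pos].
  apply nonpos_of_le_halving with (M * exp (lam * r ^ 2)). intros j.
  generalize (Hj j r Hr). lra.
Qed.

(** With w_j = 2 C / 2^j, the numbers x_j - w_j increase, the numbers x_j + w_j
    decrease, and the supremum of the former is the required limit.  The limit is
    an element of a sig type because it is used as a function of a parameter. *)
Lemma halving_limit (x : nat -> R) (C : R) :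
  (forall j, Rabs (x (S j) - x j) <= C * (1 / 2) ^ j) ->
  {l : R | forall j, Rabs (x j - l) <= 2 * C * (1 / 2) ^ j}.
Proof.
  intros Hx.
  pose (w := fun j => 2 * C * (1 / 2) ^ j).
  assert (Hw : forall j, w j = C * (1 / 2) ^ j + w (S j)).
  { intros j. unfold w. simpl. field. }
  assert (Hab : forall j, - (C * (1 / 2) ^ j) <= x (S j) - x j <= C * (1 / 2) ^ j).
  { intros j. now apply Rabs_le_between. }
  assert (Hup : forall i d, x i - w i <= x (i + d)%nat - w (i + d)%nat).
  { intros i. induction d as [| d IH]; [rewrite Nat.add_0_r; lra |].
    rewrite Nat.add_succ_r. generalize (Hw (i + d)%nat), (Hab (i + d)%nat). lra. }
  assert (Hdown : forall i d, x (i + d)%nat + w (i + d)%nat <= x i + w i).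
  { intros i. induction d as [| d IH]; [rewrite Nat.add_0_r; lra |].
    rewrite Nat.add_succ_r. generalize (Hw (i + d)%nat), (Hab (i + d)%nat). lra. }
  assert (Hw0 : forall j, 0 <= w j).
  { intros j. generalize (Hw j), (Hab j).
    replace (w (S j)) with (w j / 2) by (unfold w; simpl; field). lra. }
  assert (Hle : forall i j, x i - w i <= x j + w j).
  { intros i j. generalize (Hup i j), (Hdown j i), (Hw0 (i + j)%nat).
    rewrite (Nat.add_comm j i). lra. }
  destruct (completeness (fun y => exists i, y = x i - w i)) as [l [Hl1 Hl2]].
  - exists (x 0%nat + w 0%nat). intros y [i ->]. apply Hle.
  - exists (x 0%nat - w 0%nat). now exists 0%nat.
  - exists l. intros j. apply Rabs_le_between'. fold (w j).
    assert (H1 : x j - w j <= l) by (apply Hl1; now exists j).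
    assert (H2 : l <= x j + w j) by (apply Hl2; intros y [i ->]; apply Hle).
    lra.
Qed.

(** Picard iteration from the constant b.  The iterates are evaluated at |r|, so
    that the limit is defined and continuous on the whole line. *)
Lemma volterra_exists :
  exists V : R -> R, (forall x, continuous V x) /\
    forall r, 0 <= r -> V r = T V r.
Proof.
  assert (Hlam := weight_pos).
  pose (v := fix v (j : nat) : R -> R :=
    match j with O => fun _ => b | S j => T (v j) end).
  assert (Hv : forall j x, continuous (v j) x).
  { induction j as [| j IH]; intros x; [apply continuous_const |].
    now apply continuous_volterra_lipschitz. }
  pose (G := g (flux m kap beta (fun _ => b) 0)).
  assert (Hstep : forall j r, 0 <= r ->
    Rabs (v (S j) r - v j r) <= Rabs G * (1 / 2) ^ j * exp (lam * r ^ 2)).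
  { induction j as [| j IH]; intros r Hr.
    - change (Rabs (b - RInt (fun s => s * G) 0 r - b)
        <= Rabs G * 1 * exp (lam * r ^ 2)).
      replace (RInt (fun s => s * G) 0 r) with (r ^ 2 / 2 * G).
      2:{ symmetry. apply is_RInt_unique.
          replace (r ^ 2 / 2 * G) with (minus (r ^ 2 / 2 * G) (0 ^ 2 / 2 * G)).
          2:{ change (r ^ 2 / 2 * G - 0 ^ 2 / 2 * G = r ^ 2 / 2 * G). field. }
          apply (is_RInt_derive (fun s => s ^ 2 / 2 * G)).
          - intros s _. auto_derive; trivial. field.
          - intros s _. apply (ex_derive_continuous (V := R_NormedModule)).
            now auto_derive. }
      replace (b - r ^ 2 / 2 * G - b) with (- (G * (r ^ 2 / 2))) by ring.
      rewrite Rabs_Ropp, Rabs_mult, Rmult_1_r.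
      apply Rmult_le_compat_l; [apply Rabs_pos |].
      rewrite Rabs_pos_eq by nra.
      (* The first step is |G| r^2 / 2, which the weight dominates since
         lam >= 1. *)
      apply Rle_trans with (1 + lam * r ^ 2); [| apply exp_ineq1_le].
      assert (1 <= lam); [| nra].
      generalize (Rmult_le_pos _ _ HL
        (Rplus_le_le_0_compat _ _ (Rabs_pos beta) (Rabs_pos kap))). lra.
    - change (Rabs (T (v (S j)) r - T (v j) r)
        <= Rabs G * (1 / 2) ^ S j * exp (lam * r ^ 2)).
      replace (Rabs G * (1 / 2) ^ S j) with (Rabs G * (1 / 2) ^ j / 2)
        by (simpl; field).
      apply volterra_contract; [apply Hv | apply Hv | exact Hr |].
      intros s Hs. apply IH. lra. }
  assert (Hlim : forall r, {l : R | forall j, Rabs (v j (Rabs r) - l)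
    <= 2 * (Rabs G * exp (lam * Rabs r ^ 2)) * (1 / 2) ^ j}).
  { intros r. apply halving_limit. intros j.
    generalize (Hstep j (Rabs r) (Rabs_pos r)). lra. }
  pose (V := fun r => proj1_sig (Hlim r)).
  assert (HV : forall r j, Rabs (v j (Rabs r) - V r)
    <= 2 * (Rabs G * exp (lam * Rabs r ^ 2)) * (1 / 2) ^ j).
  { intros r. exact (proj2_sig (Hlim r)). }
  assert (HVp : forall r, 0 <= r -> forall j, Rabs (v j r - V r)
    <= 2 * (Rabs G * (1 / 2) ^ j) * exp (lam * r ^ 2)).
  { intros r Hr j. generalize (HV r j). rewrite (Rabs_pos_eq r) by trivial. lra. }
  clearbody V.
  assert (HVc : forall x, continuous V x).
  { intros x. apply continuity_pt_filterlim.
    assert (Hrho : 0 < Rabs x + 1) by (generalize (Rabs_pos x); lra).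
    apply (CVU_continuity (fun j y => v j (Rabs y)) V 0 (mkposreal _ Hrho)).
    - intros eps Heps.
      pose (C := 2 * (Rabs G * exp (lam * (Rabs x + 1) ^ 2)) + 1).
      assert (HC : 0 < C).
      { unfold C. generalize (Rabs_pos G), (exp_pos (lam * (Rabs x + 1) ^ 2)). nra. }
      destruct (pow_lt_1_zero (1 / 2) ltac:(rewrite Rabs_pos_eq; lra) (eps / C)
        ltac:(now apply Rdiv_lt_0_compat)) as [N HN].
      exists N. intros j y Hj Hy. rewrite Rabs_minus_sym.
      apply Rle_lt_trans with (1 := HV y j).
      apply Rle_lt_trans with (C * (1 / 2) ^ j).
      + apply Rmult_le_compat_r; [apply pow_le; lra |].
        assert (Hb : Rabs y < Rabs x + 1).
        { unfold Boule in Hy. simpl in Hy. now rewrite Rminus_0_r in Hy. }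
        assert (Hw := weight_le (Rabs y) (Rabs x + 1)
          ltac:(generalize (Rabs_pos y); lra)).
        unfold C. generalize (Rabs_pos G). nra.
      + assert (H := HN j Hj). rewrite Rabs_pos_eq in H by (apply pow_le; lra).
        apply (Rmult_lt_compat_l C) in H; trivial.
        now replace (C * (eps / C)) with eps in H by (field; lra).
    - intros j y _. apply continuity_pt_filterlim.
      apply (continuous_comp Rabs); [apply continuous_Rabs_all | apply Hv].
    - unfold Boule. simpl. rewrite Rminus_0_r. lra. }
  exists V. split; [exact HVc |].
  intros r Hr. apply Rminus_diag_uniq, Rabs_eq_0, Rle_antisym; [| apply Rabs_pos].
  apply nonpos_of_le_halving with (2 * Rabs G * exp (lam * r ^ 2)). intros j.
  replace (V r - T V r) with (- (v (S j) r - V r) + (T (v j) r - T V r))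
    by (simpl; ring).
  eapply Rle_trans; [apply Rabs_triang |]. rewrite Rabs_Ropp.
  assert (H1 := HVp r Hr (S j)).
  assert (H2 : Rabs (T (v j) r - T V r)
    <= 2 * (Rabs G * (1 / 2) ^ j) / 2 * exp (lam * r ^ 2)).
  { apply volterra_contract; trivial. intros s Hs. apply HVp. lra. }
  replace ((1 / 2) ^ S j) with ((1 / 2) ^ j / 2) in H1 by (simpl; field).
  lra.
Qed.

End Contraction.

(** * Monotonicity and continuation of positivity *)

(** The derivative is used in the open interval only, because the functions below
    are not known to be differentiable at the endpoints. *)
Lemma nondecreasing_of_derive (f df : R -> R) (x y : R) :
  x <= y ->
  (forall z, x < z < y -> is_derive f z (df z) /\ 0 <= df z) ->
  (forall z, x <= z <= y -> continuous f z) ->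
  f x <= f y.
Proof.
  intros Hxy Hd Hc.
  pose (df0 := fun z => if Rlt_dec x z then if Rlt_dec z y then df z else 0 else 0).
  destruct (MVT_gen f x y df0) as [z [Hz E]].
  - intros z. rewrite Rmin_left, Rmax_right by lra. intros Hz.
    unfold df0. destruct (Rlt_dec x z); [| lra]. destruct (Rlt_dec z y); [| lra].
    now apply Hd.
  - intros z. rewrite Rmin_left, Rmax_right by lra. intros Hz.
    apply continuity_pt_filterlim. now apply Hc.
  - assert (0 <= df0 z).
    { unfold df0. destruct (Rlt_dec x z); [| lra]. destruct (Rlt_dec z y); [| lra].
      now apply Hd. }
    nra.
Qed.

Lemma eq_of_derive (f g df : R -> R) (r : R) :
  0 <= r ->
  (forall x, 0 < x < r -> is_derive f x (df x)) ->
  (forall x, 0 < x < r -> is_derive g x (df x)) ->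
  (forall x, 0 <= x <= r -> continuous f x) ->
  (forall x, 0 <= x <= r -> continuous g x) ->
  f 0 = g 0 -> f r = g r.
Proof.
  assert (Hle : forall f g, 0 <= r ->
    (forall x, 0 < x < r -> is_derive f x (df x)) ->
    (forall x, 0 < x < r -> is_derive g x (df x)) ->
    (forall x, 0 <= x <= r -> continuous f x) ->
    (forall x, 0 <= x <= r -> continuous g x) ->
    f 0 = g 0 -> f r <= g r).
  { intros f1 g1 Hr Hf Hg Cf Cg E.
    assert (H : g1 0 - f1 0 <= g1 r - f1 r); [| lra].
    apply (nondecreasing_of_derive (fun x => g1 x - f1 x) (fun _ => 0)); trivial.
    - intros x Hx. split; [| lra]. evar_last.
      + apply (is_derive_minus g1 f1 x _ _ (Hg x Hx) (Hf x Hx)).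
      + apply Rminus_diag.
    - intros x Hx. apply (continuous_minus g1 f1); auto. }
  intros Hr Hf Hg Cf Cg E. apply Rle_antisym; apply Hle; auto.
Qed.

Lemma positive_near (f : R -> R) (x : R) :
  continuous f x -> 0 < f x ->
  exists d, 0 < d /\ forall y, Rabs (y - x) < d -> 0 < f y.
Proof.
  intros Hc Hx. apply continuity_pt_filterlim in Hc.
  destruct (proj1 (continuity_pt_locally f x) Hc (mkposreal _ Hx)) as [d Hd].
  exists d. split; [apply cond_pos |].
  intros y Hy. specialize (Hd y Hy). simpl in Hd.
  apply Rabs_lt_between in Hd. lra.
Qed.

(** Real induction: at the supremum of the points before which f is positive, the
    inductive hypothesis gives positivity, and continuity carries it further. *)
Lemma positive_continuation (f : R -> R) (T : R) :
  (forall x, 0 <= x < T -> continuous f x) -> 0 < f 0 ->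
  (forall r, 0 < r < T -> (forall s, 0 <= s < r -> 0 < f s) -> 0 < f r) ->
  forall r, 0 <= r < T -> 0 < f r.
Proof.
  intros Hc H0 Hstep r1 Hr1. apply Rnot_le_lt. intros Hneg.
  pose (E := fun x => 0 <= x <= r1 /\ forall s, 0 <= s <= x -> 0 < f s).
  assert (E0 : E 0) by (split; [lra | intros s Hs; now replace s with 0 by lra]).
  destruct (completeness E) as [r0 [Hub Hlub]].
  { exists r1. intros x [Hx _]. lra. }
  { now exists 0. }
  assert (Hr0 : 0 <= r0 <= r1).
  { split; [now apply Hub | apply Hlub; intros x [Hx _]; lra]. }
  assert (Hbelow : forall s, 0 <= s < r0 -> 0 < f s).
  { intros s Hs. apply Rnot_le_lt. intros Hn.
    assert (r0 <= s); [| lra]. apply Hlub. intros x [Hx HEx].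
    apply Rnot_lt_le. intros Hsx. specialize (HEx s ltac:(lra)). lra. }
  assert (Hf0 : 0 < f r0).
  { destruct (Rle_lt_or_eq_dec 0 r0 (proj1 Hr0)) as [Hp | <-]; [| exact H0].
    apply Hstep; trivial. lra. }
  destruct (positive_near f r0 (Hc r0 ltac:(lra)) Hf0) as [d [Hd Hnear]].
  assert (Hle : r0 <> r1) by (intros ->; lra).
  pose (x := Rmin r1 (r0 + d / 2)).
  assert (Hx : r0 < x <= r1 /\ x <= r0 + d / 2).
  { unfold x. repeat split; [| apply Rmin_l | apply Rmin_r].
    apply Rmin_glb_lt; lra. }
  assert (E x); [| assert (x <= r0) by (now apply Hub); lra].
  split; [lra |]. intros s Hs.
  destruct (Rlt_dec s r0) as [Hlt | Hge]; [apply Hbelow; lra |].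
  apply Hnear. rewrite Rabs_pos_eq; lra.
Qed.

Lemma pow_odd_opp (k : nat) (x : R) : Nat.Odd k -> (- x) ^ k = - x ^ k.
Proof.
  intros [j ->]. rewrite !pow_add, !pow_mult, !pow_1.
  replace ((- x) ^ 2) with (x ^ 2) by ring. ring.
Qed.

(** * The k-th root *)

Definition kroot (k : nat) (c x : R) : R := Rpower (x / c) (/ INR k).

Lemma kroot_pos (k : nat) (c x : R) : 0 < kroot k c x.
Proof. apply exp_pos. Qed.

Lemma kroot_pow (k : nat) (c x : R) :
  (1 <= k)%nat -> 0 < c -> 0 < x -> c * kroot k c x ^ k = x.
Proof.
  intros Hk Hc Hx. assert (INR k <> 0) by (apply not_0_INR; lia).
  rewrite <- Rpower_pow by apply kroot_pos. unfold kroot.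
  rewrite Rpower_mult, Rinv_l, Rpower_1; trivial; [field; lra |].
  now apply Rdiv_lt_0_compat.
Qed.

(** The form in which an identity c p^k = x between known quantities is solved
    for p. *)
Lemma kroot_unique (k : nat) (c p : R) :
  (1 <= k)%nat -> 0 < c -> 0 < p -> kroot k c (c * p ^ k) = p.
Proof.
  intros Hk Hc Hp. assert (INR k <> 0) by (apply not_0_INR; lia).
  unfold kroot. replace (c * p ^ k / c) with (p ^ k) by (field; lra).
  rewrite <- Rpower_pow, Rpower_mult, Rinv_r, Rpower_1; trivial.
Qed.

Lemma is_derive_kroot (k : nat) (c x : R) :
  (1 <= k)%nat -> 0 < c -> 0 < x ->
  is_derive (kroot k c) x (kroot k c x / (INR k * x)).
Proof.
  intros Hk Hc Hx. assert (INR k <> 0) by (apply not_0_INR; lia).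
  unfold kroot, Rpower. auto_derive.
  - now apply Rdiv_lt_0_compat.
  - unfold Rdiv. field. repeat split; lra.
Qed.

Lemma kroot_le (k : nat) (c x y : R) :
  (1 <= k)%nat -> 0 < c -> 0 < x <= y -> kroot k c x <= kroot k c y.
Proof.
  intros Hk Hc Hxy. unfold kroot. apply Rle_Rpower_l.
  - apply Rlt_le, Rinv_0_lt_compat, lt_0_INR. lia.
  - split; [apply Rdiv_lt_0_compat; lra |].
    apply Rmult_le_compat_r; [apply Rlt_le, Rinv_0_lt_compat |]; lra.
Qed.

(** The quantitative form of the strict growth of powers: away from 0 the power
    expands distances, hence the root is Lipschitz there. *)
Lemma pow_diff_ge (j : nat) (q p a : R) : 0 <= a <= q -> q <= p ->
  a ^ j * (p - q) <= p ^ S j - q ^ S j.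
Proof.
  intros Hq Hp.
  assert (H1 : a ^ j <= q ^ j) by (apply pow_incr; lra).
  assert (H2 : q ^ j <= p ^ j) by (apply pow_incr; lra).
  simpl. nra.
Qed.

Lemma kroot_truncated_lipschitz (k : nat) (c eta : R) :
  (1 <= k)%nat -> 0 < c -> 0 < eta ->
  exists L, 0 <= L /\ forall x y,
    Rabs (kroot k c (Rmax x eta) - kroot k c (Rmax y eta)) <= L * Rabs (x - y).
Proof.
  intros Hk Hc He. destruct k as [| j]; [lia |].
  pose (D := c * kroot (S j) c eta ^ j).
  assert (HD : 0 < D) by (apply Rmult_lt_0_compat; [| apply pow_lt, kroot_pos]; lra).
  exists (/ D). assert (HD' := Rinv_0_lt_compat _ HD). split; [lra |].
  assert (Hmon : forall x y, y <= x ->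
    Rabs (kroot (S j) c (Rmax x eta) - kroot (S j) c (Rmax y eta))
      <= / D * (x - y)).
  { intros x y Hyx.
    assert (H1 := Rmax_r y eta).
    assert (H2 : Rmax y eta <= Rmax x eta) by (apply Rle_max_compat_r; lra).
    assert (H3 : Rmax x eta - Rmax y eta <= x - y).
    { unfold Rmax. destruct (Rle_dec x eta), (Rle_dec y eta); lra. }
    set (X := Rmax x eta) in *. set (Y := Rmax y eta) in *.
    assert (H4 : kroot (S j) c eta <= kroot (S j) c Y) by (apply kroot_le; trivial; lra).
    assert (H5 : kroot (S j) c Y <= kroot (S j) c X) by (apply kroot_le; trivial; lra).
    assert (H6 := pow_diff_ge j (kroot (S j) c Y) (kroot (S j) c X) (kroot (S j) c eta)
      (conj (Rlt_le _ _ (kroot_pos _ _ _)) H4) H5).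
    assert (EX := kroot_pow (S j) c X Hk Hc ltac:(lra)).
    assert (EY := kroot_pow (S j) c Y Hk Hc ltac:(lra)).
    rewrite Rabs_pos_eq by lra.
    apply Rmult_le_reg_l with D; trivial.
    rewrite <- Rmult_assoc, Rinv_r, Rmult_1_l by lra.
    apply (Rmult_le_compat_l c) in H6; [| lra].
    unfold D. lra. }
  intros x y. destruct (Rle_dec y x) as [Hyx | Hyx].
  - rewrite (Rabs_pos_eq (x - y)) by lra. now apply Hmon.
  - rewrite Rabs_minus_sym, (Rabs_minus_sym x), (Rabs_pos_eq (y - x)) by lra.
    apply Hmon. lra.
Qed.

(** * The a priori estimate *)

Section Profile.

Context (m k : nat) (alpha beta c b : R).
Context (Hk : (1 <= k)%nat) (Hc : 0 < c).
Context (Hab : alpha <= beta * (INR (S m) - 2 * INR k) / INR k).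
Context (Hb : 0 < alpha * b).

Local Notation N := (INR (S m)).
Local Notation kap := (alpha - N * beta).
Local Notation Phi := (flux m kap beta).
Local Notation root := (kroot k c).

(** The function X of the introduction, alpha u + beta r u', with
    u' = - r (Phi / c)^(1/k) inserted. *)
Definition slope_excess (u : R -> R) (r : R) : R :=
  alpha * u r - beta * r ^ 2 * root (Phi u r).

(** The equation in the form u' = - r (Phi / c)^(1/k).  Positivity of Phi is part
    of the notion: without it the root would have no meaning.  At the endpoint T
    only continuity is asked, so that the notion can be used up to a possible
    first zero of Phi. *)
Definition profile_on (T : R) (u : R -> R) : Prop :=
  (forall x, continuous u x) /\ u 0 = b /\
  forall r, 0 < r < T ->
    0 < Phi u r /\ is_derive u r (- (r * root (Phi u r))).

Lemma N_pos : 0 < N.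
Proof. apply lt_0_INR. lia. Qed.

Lemma is_derive_flux (u : R -> R) (r d : R) :
  (forall x, continuous u x) -> 0 < r -> is_derive u r d ->
  is_derive (Phi u) r ((alpha * u r + beta * r * d - N * Phi u r) / r).
Proof.
  intros Hu Hr Hd. evar_last.
  - apply (is_derive_plus (fun x => beta * u x)
      (fun x => kap * mean m u x)).
    + apply (is_derive_scal u r beta d Hd).
    + apply (is_derive_scal (mean m u) r _ _ (is_derive_mean m u r Hu Hr)).
  - change (beta * d + (alpha - N * beta) * ((u r - N * mean m u r) / r) =
      (alpha * u r + beta * r * d
        - N * (beta * u r + (alpha - N * beta) * mean m u r)) / r).
    field. lra.
Qed.

Lemma is_derive_pow_flux (u : R -> R) (r d : R) :
  (forall x, continuous u x) -> 0 < r -> is_derive u r d ->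
  is_derive (fun x => x ^ S m * Phi u x) r
    (r ^ m * (alpha * u r + beta * r * d)).
Proof.
  intros Hu Hr Hd. assert (HD := is_derive_flux u r d Hu Hr Hd).
  assert (HM : is_derive (fun x => x ^ S m) r (N * r ^ m)).
  { auto_derive; trivial. change (1 * (N * r ^ m) = N * r ^ m). ring. }
  evar_last.
  - apply (is_derive_mult (fun x => x ^ S m) (Phi u) r _ _ HM HD).
    intros; apply Rmult_comm.
  - change (N * r ^ m * Phi u r
      + r * r ^ m * ((alpha * u r + beta * r * d - N * Phi u r) / r)
      = r ^ m * (alpha * u r + beta * r * d)).
    field. lra.
Qed.

Lemma is_derive_gradient (u : R -> R) (r : R) :
  (forall x, continuous u x) -> 0 < r -> 0 < Phi u r ->
  is_derive u r (- (r * root (Phi u r))) ->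
  is_derive (fun x => x * root (Phi u x)) r
    (root (Phi u r)
     * (1 + (slope_excess u r - N * Phi u r) * / (INR k * Phi u r))).
Proof.
  intros Hu Hr HP Hd. assert (HkR : INR k <> 0) by (apply not_0_INR; lia).
  assert (HD := is_derive_flux u r _ Hu Hr Hd).
  assert (HR := is_derive_comp root (Phi u) r _ _
    (is_derive_kroot k c _ Hk Hc HP) HD).
  evar_last.
  - apply (is_derive_mult (fun x => x) (fun x => root (Phi u x)) r 1 _
      (is_derive_id r) HR). intros; apply Rmult_comm.
  - set (p := root (Phi u r)) in *. unfold slope_excess. fold p.
    change (1 * p + r *
      ((alpha * u r + beta * r * - (r * p) - N * Phi u r) / r
        * (p / (INR k * Phi u r))) =
      p * (1 + (alpha * u r - beta * r ^ 2 * p - N * Phi u r)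
        * / (INR k * Phi u r))).
    field. repeat split; lra.
Qed.

(** Expressing the derivative in terms of X itself isolates the constant
    beta n / k - 2 beta - alpha, whose sign is the assumption on alpha. *)
Lemma is_derive_slope_excess (u : R -> R) (r : R) :
  (forall x, continuous u x) -> 0 < r -> 0 < Phi u r ->
  is_derive u r (- (r * root (Phi u r))) ->
  is_derive (slope_excess u) r
    (r * root (Phi u r) * (beta * N / INR k - 2 * beta - alpha)
     - beta * r * root (Phi u r) / (INR k * Phi u r) * slope_excess u r).
Proof.
  intros Hu Hr HP Hd. assert (HkR : INR k <> 0) by (apply not_0_INR; lia).
  assert (HG := is_derive_gradient u r Hu Hr HP Hd).
  assert (H1 : is_derive (fun x => beta * x) r beta).
  { auto_derive; trivial. ring. }
  assert (HX : is_derive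
    (fun x => alpha * u x - beta * x * (x * root (Phi u x))) r
    (r * root (Phi u r) * (beta * N / INR k - 2 * beta - alpha)
     - beta * r * root (Phi u r) / (INR k * Phi u r) * slope_excess u r)).
  - evar_last.
    + apply (is_derive_minus (fun x => alpha * u x)
        (fun x => beta * x * (x * root (Phi u x)))).
      * apply (is_derive_scal u r alpha _ Hd).
      * apply (is_derive_mult (fun x => beta * x) (fun x => x * root (Phi u x))
          r _ _ H1 HG). intros; apply Rmult_comm.
    + set (p := root (Phi u r)) in *. set (X := slope_excess u r) in *.
      change (alpha * - (r * p) - (beta * (r * p) + beta * r *
        (p * (1 + (X - N * Phi u r) * / (INR k * Phi u r)))) =
        r * p * (beta * N / INR k - 2 * beta - alpha) -
        beta * r * p / (INR k * Phi u r) * X).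
      field. split; lra.
  - revert HX. apply is_derive_ext. intros x. unfold slope_excess.
    change (alpha * u x - beta * x * (x * root (Phi u x)) =
      alpha * u x - beta * x ^ 2 * root (Phi u x)). ring.
Qed.

Lemma continuous_root_flux (u : R -> R) (r : R) :
  (forall x, continuous u x) -> 0 < Phi u r ->
  continuous (fun x => root (Phi u x)) r.
Proof.
  intros Hu HP. apply (continuous_comp (Phi u) root).
  - now apply continuous_flux.
  - apply (ex_derive_continuous (V := R_NormedModule)).
    eexists. now apply is_derive_kroot.
Qed.

Lemma continuous_slope_excess (u : R -> R) (r : R) :
  (forall x, continuous u x) -> 0 < Phi u r -> continuous (slope_excess u) r.
Proof.
  intros Hu HP. apply (continuous_minus (fun x => alpha * u x)
    (fun x => beta * x ^ 2 * root (Phi u x))).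
  - apply continuous_Rmult; [apply continuous_const | apply Hu].
  - apply continuous_Rmult; [| now apply continuous_root_flux].
    apply continuous_Rmult; [apply continuous_const | apply continuous_pow_all].
Qed.

Lemma flux_0_pos (u : R -> R) : u 0 = b -> 0 < Phi u 0.
Proof.
  intros E. rewrite flux_0, E. apply Rdiv_lt_0_compat; trivial.
  apply N_pos.
Qed.

Lemma flux_pos_on (T : R) (u : R -> R) :
  profile_on T u -> forall r, 0 <= r < T -> 0 < Phi u r.
Proof.
  intros [Hu [E HT]] r Hr.
  destruct (Rle_lt_or_eq_dec 0 r (proj1 Hr)) as [Hp | <-].
  - apply HT. lra.
  - now apply flux_0_pos.
Qed.

(** While X is positive, X' >= - A X with a coefficient A that is continuous, hence
    bounded, because Phi stays away from 0 on compact subintervals.  Gronwall's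
    inequality then forbids a first zero of X.  This covers the equality
    case of the assumption on alpha, in which X' = - A X. *)
Lemma slope_excess_pos (T : R) (u : R -> R) :
  profile_on T u -> forall r, 0 <= r < T -> 0 < slope_excess u r.
Proof.
  intros HT. assert (HP := flux_pos_on T u HT).
  destruct HT as [Hu [E HT]].
  assert (HkR : 0 < INR k) by (apply lt_0_INR; lia).
  assert (Hgap : 0 <= beta * N / INR k - 2 * beta - alpha).
  { replace (beta * N / INR k - 2 * beta)
      with (beta * (N - 2 * INR k) / INR k) by (field; lra).
    lra. }
  assert (Hcont : forall x, 0 <= x < T -> continuous (slope_excess u) x).
  { intros x Hx. apply continuous_slope_excess; auto. }
  apply positive_continuation; trivial.
  - unfold slope_excess. rewrite E. rewrite pow_i by lia. lra.
  - intros r Hr Hbefore.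
    pose (A := fun s => beta * s * root (Phi u s) / (INR k * Phi u s)).
    assert (HAc : forall s, 0 <= s <= r -> continuity_pt A s).
    { intros s Hs. apply continuity_pt_filterlim.
      apply (continuous_Rmult (fun s => beta * s * root (Phi u s))
        (fun s => / (INR k * Phi u s)));
        [apply (continuous_Rmult (fun s => beta * s)) |].
      - apply continuous_Rmult; [apply continuous_const | apply continuous_id].
      - apply continuous_root_flux; [apply Hu | apply HP; lra].
      - apply (continuous_comp (fun s => INR k * Phi u s) Rinv).
        + apply continuous_Rmult; [apply continuous_const |].
          now apply continuous_flux.
        + apply continuous_Rinv.
          assert (0 < Phi u s) by (apply HP; lra). nra. }
    destruct (continuity_ab_maj A 0 r ltac:(lra) HAc) as [s0 [Hmax _]].
    set (B := A s0) in *.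
    (* A constant exponent B, the maximum of A, serves as integrating factor, as
       X >= 0 on the interval considered. *)
    pose (Y := fun s => slope_excess u s * exp (B * s)).
    assert (HY : Y 0 <= Y r).
    { apply nondecreasing_of_derive with (fun s =>
        (s * root (Phi u s) * (beta * N / INR k - 2 * beta - alpha)
         + (B - A s) * slope_excess u s) * exp (B * s)); [lra | |].
      - intros s Hs.
        assert (HPs : 0 < Phi u s) by (apply HP; lra).
        assert (HAs : A s <= B) by (apply Hmax; lra).
        assert (Hss : 0 < slope_excess u s) by (apply Hbefore; lra).
        assert (HE : is_derive (fun s => exp (B * s)) s (B * exp (B * s))).
        { auto_derive; trivial. ring. }
        assert (HS := is_derive_slope_excess u s Hu ltac:(lra) HPs
          (proj2 (HT s ltac:(lra)))).
        split.
        + evar_last.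
          * apply (is_derive_mult (slope_excess u) (fun s => exp (B * s)) s _ _ HS HE).
            intros; apply Rmult_comm.
          * change ((s * root (Phi u s) * (beta * N / INR k - 2 * beta - alpha)
              - A s * slope_excess u s) * exp (B * s)
              + slope_excess u s * (B * exp (B * s)) =
              (s * root (Phi u s) * (beta * N / INR k - 2 * beta - alpha)
              + (B - A s) * slope_excess u s) * exp (B * s)).
            ring.
        + apply Rmult_le_pos; [| apply Rlt_le, exp_pos].
          apply Rplus_le_le_0_compat; apply Rmult_le_pos; try lra.
          apply Rmult_le_pos; [lra | apply Rlt_le, kroot_pos].
      - intros s Hs. apply continuous_Rmult; [apply Hcont; lra |].
        apply (ex_derive_continuous (V := R_NormedModule)). auto_derive. trivial. }
    unfold Y in HY. rewrite Rmult_0_r, exp_0 in HY.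
    assert (H0 := Hbefore 0 ltac:(lra)). generalize (exp_pos (B * r)). nra.
Qed.

(** (r^n Phi)' = r^(n-1) X > 0.  The bound holds up to the endpoint T, where Phi
    could a priori vanish. *)
Lemma flux_growth (T s r : R) (u : R -> R) :
  profile_on T u -> 0 < s <= r -> r <= T ->
  s ^ S m * Phi u s <= r ^ S m * Phi u r.
Proof.
  intros HT Hs Hr. assert (HX := slope_excess_pos T u HT).
  destruct HT as [Hu [E HT]].
  apply (nondecreasing_of_derive (fun x => x ^ S m * Phi u x)
    (fun x => x ^ m * slope_excess u x)); [lra | |].
  - intros x Hx. split.
    + evar_last.
      * apply (is_derive_pow_flux u x _ Hu ltac:(lra) (proj2 (HT x ltac:(lra)))).
      * unfold slope_excess. simpl. ring.
    + apply Rmult_le_pos; [apply pow_le; lra |]. apply Rlt_le, HX. lra.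
  - intros x _. apply continuous_Rmult; [apply continuous_pow_all |].
    now apply continuous_flux.
Qed.

Lemma flux_pos_at_end (T : R) (u : R -> R) :
  0 < T -> profile_on T u -> 0 < Phi u T.
Proof.
  intros HT Hu.
  assert (H := flux_growth T (T / 2) T u Hu ltac:(lra) ltac:(lra)).
  assert (HP := flux_pos_on T u Hu (T / 2) ltac:(lra)).
  assert (H1 : 0 < (T / 2) ^ S m) by (apply pow_lt; lra).
  assert (H2 : 0 < T ^ S m) by (apply pow_lt; lra).
  apply Rmult_lt_reg_l with (T ^ S m); trivial. rewrite Rmult_0_r.
  apply Rlt_le_trans with (2 := H). now apply Rmult_lt_0_compat.
Qed.

(** * Existence and uniqueness of the profile *)

(** The equation in integrated form.  It differs from [profile_on] in that the
    closed interval is used: Phi is then bounded below by a positive constant. *)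
Definition solves_upto (R0 : R) (V : R -> R) : Prop :=
  (forall x, continuous V x) /\
  forall r, 0 <= r <= R0 ->
    0 < Phi V r /\ V r = volterra m kap beta b root V r.

Lemma volterra_0 (g f : R -> R) : volterra m kap beta b g f 0 = b.
Proof.
  unfold volterra. rewrite RInt_point. unfold zero; simpl. ring.
Qed.

Lemma is_derive_of_volterra (g V : R -> R) (r : R) :
  (forall x, continuous V x) -> (forall x, continuous g x) ->
  (forall s, 0 <= s -> V s = volterra m kap beta b g V s) -> 0 < r ->
  is_derive V r (- (r * g (Phi V r))).
Proof.
  intros HV Hg E Hr.
  apply (is_derive_ext_loc (volterra m kap beta b g V)).
  - exists (mkposreal r Hr). intros y Hy.
    change (Rabs (y - r) < r) in Hy. apply Rabs_lt_between in Hy.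
    symmetry. apply E. lra.
  - rewrite <- (Rabs_pos_eq r) at 3 by lra.
    apply is_derive_volterra; auto.
Qed.

(** On a compact interval Phi is bounded below by some eta > 0 for both solutions,
    so both solve the equation truncated at eta, for which uniqueness holds. *)
Lemma solves_upto_unique (R0 : R) (V W : R -> R) :
  solves_upto R0 V -> solves_upto R0 W -> forall r, 0 <= r <= R0 -> V r = W r.
Proof.
  intros [HV EV] [HW EW] r Hr.
  assert (Hmin : forall f, (forall x, continuous f x) ->
    (forall s, 0 <= s <= R0 -> 0 < Phi f s) ->
    exists eta, 0 < eta /\ forall s, 0 <= s <= R0 -> eta <= Phi f s).
  { intros f Hf HP.
    destruct (continuity_ab_min (Phi f) 0 R0 ltac:(lra)) as [s0 [Hs0 Hin]].
    { intros s _. apply continuity_pt_filterlim. now apply continuous_flux. }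
    exists (Phi f s0). auto. }
  destruct (Hmin V HV (fun s Hs => proj1 (EV s Hs))) as [eV [HeV LV]].
  destruct (Hmin W HW (fun s Hs => proj1 (EW s Hs))) as [eW [HeW LW]].
  pose (eta := Rmin eV eW).
  destruct (kroot_truncated_lipschitz k c eta Hk Hc ltac:(now apply Rmin_pos))
    as [L [HL Hlip]].
  apply (volterra_unique m kap beta b L (fun x => kroot k c (Rmax x eta)) HL Hlip
    V W R0); trivial.
  - intros s Hs. rewrite (proj2 (EV s Hs)). apply volterra_ext; trivial; [lra |].
    intros t Ht. rewrite Rmax_left; trivial.
    apply Rle_trans with (1 := Rmin_l eV eW). apply LV. lra.
  - intros s Hs. rewrite (proj2 (EW s Hs)). apply volterra_ext; trivial; [lra |].
    intros t Ht. rewrite Rmax_left; trivial.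
    apply Rle_trans with (1 := Rmin_r eV eW). apply LW. lra.
Qed.

(** A profile solves the integrated equation, as both sides have the same
    derivative and the same value at 0. *)
Lemma profile_unique (u1 u2 : R -> R) :
  (forall T, profile_on T u1) -> (forall T, profile_on T u2) ->
  forall r, 0 <= r -> u1 r = u2 r.
Proof.
  assert (HS : forall u, (forall T, profile_on T u) ->
    forall R0, solves_upto R0 u).
  { intros u Hu R0.
    assert (HP : forall x, 0 <= x -> 0 < Phi u x).
    { intros x Hx. apply (flux_pos_on (x + 1) u (Hu _)). lra. }
    destruct (Hu 0) as [Huc [Hub _]].
    split; [exact Huc |]. intros r Hr. split; [apply HP; lra |].
    assert (Hroot : forall x, 0 <= x -> continuous root (Phi u x)).
    { intros x Hx. apply (ex_derive_continuous (V := R_NormedModule)).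
      eexists. apply is_derive_kroot; auto. }
    apply (eq_of_derive u (volterra m kap beta b root u)
      (fun x => - (x * root (Phi u x)))); [lra | | | | |].
    - intros x Hx. destruct (Hu r) as [_ [_ HT]]. now apply HT.
    - intros x Hx. rewrite <- (Rabs_pos_eq x) at 3 by lra.
      now apply is_derive_volterra.
    - intros x _. apply Huc.
    - intros x _. now apply continuous_volterra.
    - rewrite volterra_0. exact Hub. }
  intros H1 H2 r Hr. apply (solves_upto_unique r); auto. lra.
Qed.

(** The first integral alone does not determine the sign of u'.  It does where
    Phi > 0, as k is odd, and [flux_pos_at_end] shows by continuation from
    Phi(0) > 0 that this is everywhere. *)
Lemma gradient_is_profile (u e : R -> R) :
  Nat.Odd k -> (k <= S m)%nat ->
  (forall x, continuous u x) -> u 0 = b ->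
  (forall r, 0 < r -> is_derive u r (e r)) ->
  (forall r, 0 < r -> c * (r ^ (S m - k) * e r ^ k) = - (r ^ S m * Phi u r)) ->
  forall T, profile_on T u.
Proof.
  intros Hodd Hkm Hu Hub Hd Hint.
  assert (Hloc : forall r, 0 < r -> 0 < Phi u r -> e r = - (r * root (Phi u r))).
  { intros r Hr HP.
    pose (q := - e r / r).
    assert (Eq : e r = - (r * q)) by (unfold q; field; lra).
    assert (Hrk : 0 < r ^ k) by now apply pow_lt.
    assert (Hrmk : 0 < r ^ (S m - k)) by now apply pow_lt.
    assert (EP : c * q ^ k = Phi u r).
    { assert (H := Hint r Hr). rewrite Eq, pow_odd_opp, Rpow_mult_distr in H by trivial.
      replace (r ^ S m) with (r ^ (S m - k) * r ^ k) in H
        by (rewrite <- pow_add; f_equal; lia).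
      apply Rmult_eq_reg_l with (r ^ (S m - k) * r ^ k); [lra |].
      apply Rgt_not_eq. now apply Rmult_lt_0_compat. }
    assert (Hq : 0 < q).
    { apply Rnot_le_lt. intros Hq.
      assert (H : 0 <= (- q) ^ k) by (apply pow_le; lra).
      rewrite pow_odd_opp in H by trivial. nra. }
    rewrite Eq, <- EP, kroot_unique; trivial. }
  assert (HP : forall T r, 0 <= r < T -> 0 < Phi u r).
  { intros T. apply positive_continuation.
    - intros x _. now apply continuous_flux.
    - now apply flux_0_pos.
    - intros r Hr Hbefore. apply flux_pos_at_end; [lra |].
      split; [exact Hu | split; [exact Hub |]]. intros s Hs.
      assert (H := Hbefore s ltac:(lra)). split; [exact H |].
      rewrite <- Hloc by (trivial; lra). apply Hd. lra. }
  intros T. split; [exact Hu | split; [exact Hub |]]. intros s Hs.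
  assert (H := HP T s ltac:(lra)). split; [exact H |].
  rewrite <- Hloc by (trivial; lra). apply Hd. lra.
Qed.

(** A solution truncated at eta0 = Phi(0) / 2 has Phi > eta0 on some [0, rho].
    Truncating at eta0 (rho / R1)^n instead does not change it there, and since
    r^n Phi is nondecreasing, Phi remains above the new level up to R1: on
    [0, R1) the truncation is never active. *)
Lemma solves_upto_exists (R0 : R) : exists V, solves_upto R0 V.
Proof.
  assert (HN := N_pos).
  pose (eta0 := alpha * b / N / 2).
  assert (Heta0 : 0 < eta0).
  { unfold eta0. apply Rdiv_lt_0_compat; [apply Rdiv_lt_0_compat |]; lra. }
  assert (HP0 : forall V, V 0 = b -> Phi V 0 = 2 * eta0).
  { intros V E. rewrite flux_0, E. unfold eta0. field.
    apply not_0_INR. lia. }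
  assert (Htrunc : forall eta, 0 < eta ->
    exists V L, 0 <= L /\ (forall x y, Rabs (kroot k c (Rmax x eta)
        - kroot k c (Rmax y eta)) <= L * Rabs (x - y)) /\
      (forall x, continuous V x) /\ forall r, 0 <= r ->
        V r = volterra m kap beta b (fun x => kroot k c (Rmax x eta)) V r).
  { intros eta He.
    destruct (kroot_truncated_lipschitz k c eta Hk Hc He) as [L [HL Hlip]].
    destruct (volterra_exists m kap beta b L _ HL Hlip) as [V [HV E]].
    now exists V, L. }
  destruct (Htrunc eta0 Heta0) as [V0 [L0 [_ [_ [HV0 E0]]]]].
  assert (HV00 : V0 0 = b) by (rewrite E0 by lra; apply volterra_0).
  assert (Hrho : exists rho, 0 < rho /\
    forall r, 0 <= r <= rho -> eta0 < Phi V0 r).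
  { destruct (positive_near (fun r => Phi V0 r - eta0) 0) as [d [Hd Hnear]].
    - apply (continuous_minus (Phi V0) (fun _ => eta0)); [| apply continuous_const].
      now apply continuous_flux.
    - rewrite (HP0 V0 HV00). lra.
    - exists (d / 2). split; [lra |]. intros r Hr.
      specialize (Hnear r). rewrite Rminus_0_r, Rabs_pos_eq in Hnear by lra.
      specialize (Hnear ltac:(lra)). lra. }
  destruct Hrho as [rho [Hrho HV0P]].
  pose (R1 := Rmax R0 rho + 1).
  assert (HR1 : R0 < R1 /\ rho < R1).
  { unfold R1. generalize (Rmax_l R0 rho), (Rmax_r R0 rho). lra. }
  pose (q := (rho / R1) ^ S m).
  assert (Hquot : 0 < rho / R1 <= 1).
  { split; [apply Rdiv_lt_0_compat; lra |].
    apply Rmult_le_reg_r with R1; [lra |].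
    unfold Rdiv. rewrite Rmult_assoc, Rinv_l; lra. }
  assert (Hq : 0 < q <= 1).
  { split; [now apply pow_lt |]. unfold q. rewrite <- (pow1 (S m)).
    apply pow_incr. lra. }
  pose (eta := eta0 * q).
  assert (Heta : 0 < eta <= eta0) by (unfold eta; nra).
  destruct (Htrunc eta (proj1 Heta)) as [V [L [HL [Hlip [HV E]]]]].
  assert (HVb : V 0 = b) by (rewrite E by lra; apply volterra_0).
  assert (Heq : forall r, 0 <= r <= rho -> V0 r = V r).
  { apply (volterra_unique m kap beta b L _ HL Hlip V0 V rho); trivial.
    - intros r Hr. rewrite E0 by lra. apply volterra_ext; trivial; [lra |].
      intros s Hs. assert (H := HV0P s ltac:(lra)).
      rewrite !Rmax_left by lra. reflexivity.
    - intros r Hr. apply E. lra. }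
  (* The function V0, whose flux exceeds both levels on [0, rho], solves both
     truncated equations there. *)
  assert (Hearly : forall r, 0 <= r <= rho -> eta0 < Phi V r).
  { intros r Hr. replace (Phi V r) with (Phi V0 r); [now apply HV0P |].
    apply flux_ext; trivial; [lra |]. intros s Hs. apply Heq. lra. }
  assert (Hbound : forall r, 0 <= r < R1 -> 0 < Phi V r - eta).
  { apply positive_continuation.
    - intros x _. apply (continuous_minus (Phi V) (fun _ => eta));
        [now apply continuous_flux | apply continuous_const].
    - rewrite (HP0 V HVb). lra.
    - intros r Hr Hbefore.
      destruct (Rle_dec r rho) as [Hle | Hgt].
      { generalize (Hearly r ltac:(lra)). lra. }
      assert (Hprof : profile_on r V).
      { split; [exact HV | split; [exact HVb |]]. intros s Hs.
        assert (H := Hbefore s ltac:(lra)). split; [lra |].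
        replace (root (Phi V s)) with (kroot k c (Rmax (Phi V s) eta))
          by (rewrite Rmax_left by lra; reflexivity).
        apply (is_derive_of_volterra (fun x => kroot k c (Rmax x eta)));
          trivial; [| lra].
        intros x. now apply lipschitz_continuous with L. }
      (* r^n Phi(r) >= rho^n Phi(rho) > rho^n eta0 = R1^n eta >= r^n eta. *)
      assert (HG := flux_growth r rho r V Hprof ltac:(lra) ltac:(lra)).
      assert (HE := Hearly rho ltac:(lra)).
      assert (Hpr : 0 < r ^ S m) by (apply pow_lt; lra).
      assert (HpR : r ^ S m <= R1 ^ S m) by (apply pow_incr; lra).
      assert (Hprho : 0 < rho ^ S m) by (apply pow_lt; lra).
      assert (Hqe : R1 ^ S m * q = rho ^ S m).
      { unfold q. rewrite <- Rpow_mult_distr. f_equal. field. lra. }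
      apply Rlt_0_minus. apply Rmult_lt_reg_l with (r ^ S m); trivial.
      apply Rlt_le_trans with (2 := HG).
      apply Rle_lt_trans with (rho ^ S m * eta0).
      + rewrite <- Hqe. unfold eta.
        replace (R1 ^ S m * q * eta0) with (R1 ^ S m * (eta0 * q)) by ring.
        apply Rmult_le_compat_r; trivial. fold eta. lra.
      + now apply Rmult_lt_compat_l. }
  exists V. split; [exact HV |]. intros r Hr. split.
  - generalize (Hbound r ltac:(lra)). lra.
  - rewrite E by lra. apply volterra_ext; trivial; [lra |].
    intros s Hs. rewrite Rmax_left; [reflexivity |].
    generalize (Hbound s ltac:(lra)). lra.
Qed.

(** The solutions on the intervals [0, R] are glued by uniqueness into U.  Then
    the Volterra operator is applied once more: this does not change U on the
    half-line, and makes it differentiable on the whole line, also at 0. *)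
Lemma profile_exists :
  exists u : R -> R, (forall x, continuous u x) /\ u 0 = b /\
    (forall r, 0 <= r -> 0 < Phi u r) /\
    forall r, is_derive u r (- (r * root (Phi u (Rabs r)))).
Proof.
  pose (W := fun R0 => proj1_sig (constructive_indefinite_description _
    (solves_upto_exists R0))).
  assert (HW : forall R0, solves_upto R0 (W R0)).
  { intros R0. exact (proj2_sig (constructive_indefinite_description _
      (solves_upto_exists R0))). }
  clearbody W.
  assert (Hcomp : forall R1 R2 r, 0 <= r <= R1 -> r <= R2 -> W R1 r = W R2 r).
  { intros R1 R2 r H1 H2.
    apply (solves_upto_unique r); [| | lra]; split; try apply HW;
      intros s Hs; apply HW; lra. }
  (* The margin 1 makes U equal, near each point, to one fixed solution. *)
  pose (U := fun r => W (Rabs r + 1) (Rabs r)).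
  assert (HU : forall R0 r, 0 <= r <= R0 -> U r = W R0 r).
  { intros R0 r Hr. unfold U. rewrite Rabs_pos_eq by lra. apply Hcomp; lra. }
  assert (HUc : forall x, continuous U x).
  { intros x. apply (continuous_ext_loc _ (fun r => W (Rabs x + 1) (Rabs r))).
    - exists (mkposreal 1 Rlt_0_1). intros y Hy. change (Rabs (y - x) < 1) in Hy.
      assert (H := Rabs_triang_inv y x).
      unfold U. apply Hcomp; generalize (Rabs_pos y); lra.
    - apply (continuous_comp Rabs); [apply continuous_Rabs_all | apply HW]. }
  assert (HUW : forall r, 0 <= r -> Phi U r = Phi (W r) r).
  { intros r Hr. apply flux_ext; trivial; [apply HW |].
    intros s Hs. apply HU. lra. }
  assert (HUP : forall r, 0 <= r -> 0 < Phi U r).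
  { intros r Hr. rewrite HUW by trivial. apply HW. lra. }
  assert (HUE : forall r, 0 <= r -> U r = volterra m kap beta b root U r).
  { intros r Hr. rewrite (HU r r) by lra.
    rewrite (proj2 (proj2 (HW r) r ltac:(lra))).
    apply volterra_ext; trivial; [apply HW |].
    intros s Hs. symmetry. apply HU. lra. }
  assert (Hroot : forall x, 0 <= x -> continuous root (Phi U x)).
  { intros x Hx. apply (ex_derive_continuous (V := R_NormedModule)).
    eexists. apply is_derive_kroot; auto. }
  pose (u := volterra m kap beta b root U).
  assert (Huc : forall x, continuous u x).
  { intros x. now apply continuous_volterra. }
  assert (HuU : forall r, 0 <= r -> Phi u r = Phi U r).
  { intros r Hr. apply flux_ext; trivial. intros s Hs. symmetry. apply HUE. lra. }
  exists u. split; [exact Huc | split; [apply volterra_0 | split]].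
  - intros r Hr. rewrite HuU; auto.
  - intros r. rewrite HuU by apply Rabs_pos. now apply is_derive_volterra.
Qed.

End Profile.

(** * Derivatives relative to the half-line *)

Lemma is_filter_lim_within (D : R -> Prop) (x : R) :
  is_filter_lim (within D (locally x)) x.
Proof. intros P [d Hd]. exists d. intros z Hz _. now apply Hd. Qed.

Lemma within_locally_proper (D : R -> Prop) (x : R) :
  D x -> ProperFilter (within D (locally x)).
Proof.
  intros HD. split; [| apply within_filter, locally_filter].
  intros P [d Hd]. exists x. apply Hd; [apply ball_center | exact HD].
Qed.

Lemma is_derive_on_of_is_derive (D : R -> Prop) (f : R -> R) (x l : R) :
  D x -> is_derive f x l -> is_derive_on D f x l.
Proof.
  intros HD Hf.
  apply (filterdiff_locally (FF := within_locally_proper D x HD) f x); trivial.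
  apply is_filter_lim_within.
Qed.

Lemma is_derive_on_bound (D : R -> Prop) (f : R -> R) (x l : R) (eps : posreal) :
  is_derive_on D f x l ->
  exists d : posreal, forall y, D y -> Rabs (y - x) < d ->
    Rabs (f y - f x - (y - x) * l) <= eps * Rabs (y - x).
Proof.
  intros [_ Hdom].
  destruct (Hdom x (is_filter_lim_within D x) eps) as [d Hd]. exists d. intros y Dy Hy.
  exact (Hd y Hy Dy).
Qed.

Lemma is_derive_of_bound (f : R -> R) (x l : R) :
  (forall eps : posreal, exists d : posreal, forall y, Rabs (y - x) < d ->
    Rabs (f y - f x - (y - x) * l) <= eps * Rabs (y - x)) ->
  is_derive f x l.
Proof.
  intros H. split; [apply is_linear_scal_l |].
  intros y Hy.
  apply (is_filter_lim_locally_unique (V := R_NormedModule) x y) in Hy. subst y.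
  intros eps. destruct (H eps) as [d Hd]. exists d. exact Hd.
Qed.

Lemma is_derive_of_on_positive (D : R -> Prop) (f : R -> R) (x l : R) :
  (forall y, 0 < y -> D y) -> 0 < x -> is_derive_on D f x l -> is_derive f x l.
Proof.
  intros HD Hx Hf. apply is_derive_of_bound. intros eps.
  destruct (is_derive_on_bound D f x l eps Hf) as [d Hd].
  assert (Hm : 0 < Rmin d x) by (apply Rmin_pos; [apply cond_pos | exact Hx]).
  exists (mkposreal _ Hm). intros y Hy.
  change (Rabs (y - x) < Rmin d x) in Hy.
  assert (H1 := Rlt_le_trans _ _ _ Hy (Rmin_l _ _)).
  assert (H2 := Rlt_le_trans _ _ _ Hy (Rmin_r _ _)).
  apply Rabs_lt_between in H2. apply Hd; [apply HD; lra | exact H1].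
Qed.

(** This identifies the value at 0 of the derivative supplied by the regularity
    of a solution with the prescribed one-sided derivative. *)
Lemma derive_on_unique_0 (f : R -> R) (l1 l2 : R) :
  is_derive_on (Ico0 p_infty) f 0 l1 -> is_derive_on (Ico0 p_infty) f 0 l2 ->
  l1 = l2.
Proof.
  intros H1 H2. apply Rminus_diag_uniq. apply Rabs_eq_0, Rle_antisym; [| apply Rabs_pos].
  apply le_epsilon. intros e He.
  assert (He2 : 0 < e / 2) by lra.
  destruct (is_derive_on_bound _ _ _ _ (mkposreal _ He2) H1) as [d1 Hd1].
  destruct (is_derive_on_bound _ _ _ _ (mkposreal _ He2) H2) as [d2 Hd2].
  simpl in Hd1, Hd2.
  assert (Hm : 0 < Rmin d1 d2) by (apply Rmin_pos; apply cond_pos).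
  pose (y := Rmin d1 d2 / 2).
  assert (Hy1 : y < d1) by (unfold y; generalize (Rmin_l d1 d2); lra).
  assert (Hy2 : y < d2) by (unfold y; generalize (Rmin_r d1 d2); lra).
  assert (Hy : 0 < y) by (unfold y; lra).
  specialize (Hd1 y). specialize (Hd2 y).
  rewrite Rminus_0_r, (Rabs_pos_eq y) in Hd1, Hd2 by lra.
  specialize (Hd1 (conj (Rlt_le _ _ Hy) I) Hy1).
  specialize (Hd2 (conj (Rlt_le _ _ Hy) I) Hy2).
  apply Rabs_le_between in Hd1. apply Rabs_le_between in Hd2.
  apply Rabs_le. nra.
Qed.

(** Composition with the absolute value turns one-sided continuity at 0 into
    continuity on the line; solutions are always extended in this way. *)
Lemma continuous_comp_Rabs (f : R -> R) :
  continuous_on (Ico0 p_infty) f -> forall x, continuous (fun r => f (Rabs r)) x.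
Proof.
  intros Hf x. apply continuity_pt_filterlim, continuity_pt_locally. intros eps.
  assert (Hx : Ico0 p_infty (Rabs x)) by (split; [apply Rabs_pos | exact I]).
  destruct (Hf _ Hx (ball (f (Rabs x)) eps) (locally_ball _ eps)) as [d Hd].
  exists d. intros y Hy. apply Hd; [| split; [apply Rabs_pos | exact I]].
  apply Rle_lt_trans with (2 := Hy). apply Rabs_triang_inv2.
Qed.

Lemma continuous_on_of_derive (D : R -> Prop) (f f' : R -> R) :
  (forall x, D x -> is_derive_on D f x (f' x)) -> continuous_on D f.
Proof.
  intros Hf x Dx.
  apply (filterdiff_continuous_aux (U := R_NormedModule) (V := R_NormedModule)).
  - eexists. exact (Hf x Dx).
  - apply is_filter_lim_within.
Qed.

Lemma locally_positive (x : R) (P : R -> Prop) :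
  0 < x -> (forall y, 0 < y -> P y) -> locally x P.
Proof.
  intros Hx HP. exists (mkposreal x Hx). intros y Hy.
  change (Rabs (y - x) < x) in Hy. apply Rabs_lt_between in Hy. apply HP. lra.
Qed.

(** * From solutions to the first integral *)

Lemma c_coef_pos (n k : nat) : (1 <= n)%nat -> (k <= n)%nat -> 0 < c_coef n k.
Proof.
  intros Hn Hk. unfold c_coef, Binomial.C.
  apply Rmult_lt_0_compat; [apply Rinv_0_lt_compat, lt_0_INR; lia |].
  apply Rdiv_lt_0_compat; [apply INR_fact_lt_0 |].
  apply Rmult_lt_0_compat; apply INR_fact_lt_0.
Qed.

Lemma powerRZ_succ_cancel (m : nat) (r : R) : 0 < r ->
  powerRZ r (1 - Z.of_nat (S m)) * r ^ m = 1.
Proof.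
  intros Hr. rewrite pow_powerRZ, <- powerRZ_add by lra.
  replace (1 - Z.of_nat (S m) + Z.of_nat m)%Z with 0%Z by lia. reflexivity.
Qed.

(** What the definition of a solution gives: a continuous gradient e vanishing at 0
    such that the equation expresses the derivative of r^(n-k) e^k.  This
    function is differentiable since e is, by the C^2 regularity away from 0. *)
Lemma solution_flow (m k : nat) (alpha beta a : R) (w : R -> R) :
  (1 <= k)%nat -> (k <= S m)%nat ->
  is_solution (S m) k alpha beta a p_infty w ->
  exists e : R -> R,
    (forall x, continuous (fun r => w (Rabs r)) x) /\
    (forall x, continuous (fun r => e (Rabs r)) x) /\ e 0 = 0 /\
    forall r, 0 < r -> is_derive w r (e r) /\
      is_derive (fun s => s ^ (S m - k) * e s ^ k) r
        (- / c_coef (S m) k * (r ^ m * (alpha * w r + beta * r * e r))).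
Proof.
  intros Hk Hkm [[e [He Hec]] [[e2 [He2 [e3 [He3 _]]]] [_ [Heq [_ H0]]]]].
  assert (Hc := c_coef_pos (S m) k ltac:(lia) Hkm).
  exists e. split; [| split; [| split]].
  - apply continuous_comp_Rabs. now apply continuous_on_of_derive with e.
  - now apply continuous_comp_Rabs.
  - apply derive_on_unique_0 with w; trivial. apply He.
    split; [apply Rle_refl | exact I].
  - assert (Hw : forall r, 0 < r -> is_derive w r (e r)).
    { intros r Hr. apply (is_derive_of_on_positive (Ico0 p_infty)); trivial.
      - intros y Hy. split; [now apply Rlt_le | exact I].
      - apply He. split; [now apply Rlt_le | exact I]. }
    intros r Hr. split; [now apply Hw |].
    assert (Hee : forall s, 0 < s -> e2 s = e s).
    { intros s Hs. rewrite <- (is_derive_unique _ _ _ (Hw s Hs)).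
      symmetry. apply is_derive_unique.
      apply (is_derive_of_on_positive (Ioo0 p_infty)); trivial.
      - intros y Hy. now split.
      - apply He2. now split. }
    assert (Hd2 : is_derive e r (e3 r)).
    { apply (is_derive_ext_loc e2).
      - now apply locally_positive.
      - apply (is_derive_of_on_positive (Ioo0 p_infty)); trivial.
        + intros y Hy. now split.
        + apply He3. now split. }
    assert (Hex : ex_derive (fun s => s ^ (S m - k) * e s ^ k) r).
    { apply ex_derive_mult.
      - auto_derive. trivial.
      - apply ex_derive_pow. now exists (e3 r). }
    apply Derive_correct in Hex.
    assert (Hr0 := Heq r (conj Hr I)). unfold radial_lhs in Hr0.
    rewrite (is_derive_unique _ _ _ (Hw r Hr)) in Hr0.
    rewrite (Derive_ext_loc _ (fun s => s ^ (S m - k) * e s ^ k)) in Hr0.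
    2:{ apply locally_positive; trivial. intros y Hy.
        now rewrite (is_derive_unique _ _ _ (Hw y Hy)). }
    set (y' := Derive (fun s => s ^ (S m - k) * e s ^ k) r) in *.
    replace (- / c_coef (S m) k * (r ^ m * (alpha * w r + beta * r * e r)))
      with y'; [exact Hex |].
    assert (Hp := powerRZ_succ_cancel m r Hr).
    set (P := powerRZ r (1 - Z.of_nat (S m))) in *.
    change (c_coef (S m) k * P * y' + alpha * w r + beta * r * e r = 0) in Hr0.
    replace (alpha * w r + beta * r * e r) with (- (c_coef (S m) k * P * y')) by lra.
    transitivity (P * r ^ m * y'); [rewrite Hp; ring | field; lra].
Qed.

(** Both sides have the derivative - s^m (alpha u + beta s u') and vanish
    at 0. *)
Lemma first_integral (m k : nat) (alpha beta c : R) (u e : R -> R) :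
  (1 <= k)%nat -> 0 < c ->
  (forall x, continuous u x) -> (forall x, continuous e x) -> e 0 = 0 ->
  (forall r, 0 < r -> is_derive u r (e r) /\
     is_derive (fun s => s ^ (S m - k) * e s ^ k) r
       (- / c * (r ^ m * (alpha * u r + beta * r * e r)))) ->
  forall r, 0 <= r ->
    c * (r ^ (S m - k) * e r ^ k)
      = - (r ^ S m * flux m (alpha - INR (S m) * beta) beta u r).
Proof.
  intros Hk Hc Hu He He0 Hd r Hr.
  assert (H : r ^ (S m - k) * e r ^ k
    = - / c * (r ^ S m * flux m (alpha - INR (S m) * beta) beta u r)).
  2:{ rewrite H. field. lra. }
  apply (eq_of_derive (fun s => s ^ (S m - k) * e s ^ k)
    (fun s => - / c * (s ^ S m * flux m (alpha - INR (S m) * beta) beta u s))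
    (fun s => - / c * (s ^ m * (alpha * u s + beta * s * e s)))); trivial.
  - intros x Hx. apply Hd. lra.
  - intros x Hx. apply (is_derive_scal
      (fun s => s ^ S m * flux m (alpha - INR (S m) * beta) beta u s)).
    apply is_derive_pow_flux; trivial; [lra |]. apply Hd. lra.
  - intros x _. apply continuous_Rmult; [apply continuous_pow_all |].
    apply (continuous_comp e (fun y => y ^ k)); [apply He | apply continuous_pow_all].
  - intros x _. apply continuous_Rmult; [apply continuous_const |].
    apply continuous_Rmult; [apply continuous_pow_all | now apply continuous_flux].
  - rewrite He0, (pow_i k), (pow_i (S m)) by lia. ring.
Qed.

Lemma is_derive_comp_Rabs (f : R -> R) (r l : R) :
  0 < r -> is_derive f r l -> is_derive (fun s => f (Rabs s)) r l.
Proof.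
  intros Hr. apply is_derive_ext_loc. apply locally_positive; trivial.
  intros y Hy. now rewrite Rabs_pos_eq by lra.
Qed.

(** * Back to the original equation *)

Lemma sign_pow_odd (k : nat) (sg : R) :
  Nat.Odd k -> sg = 1 \/ sg = -1 -> sg ^ k = sg.
Proof.
  intros Hk [-> | ->]; [apply pow1 |].
  replace (-1) with (- (1)) by ring. now rewrite pow_odd_opp, pow1.
Qed.

(** The equation is the derivative of the first integral, divided by r^(n-1).
    Regularity C^2 away from 0 holds because Phi is C^1 and positive; positivity
    of v comes from alpha u = X + beta r^2 p, a sum of positive terms. *)
Lemma profile_solution (m k : nat) (alpha beta b sg : R) (u : R -> R) :
  Nat.Odd k -> (1 <= k)%nat -> (k <= S m)%nat -> 0 < beta ->
  alpha <= beta * (INR (S m) - 2 * INR k) / INR k -> 0 < alpha * b ->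
  sg = 1 \/ sg = -1 -> 0 < sg * alpha ->
  let Phi := flux m (alpha - INR (S m) * beta) beta u in
  let root := kroot k (c_coef (S m) k) in
  (forall x, continuous u x) -> u 0 = b ->
  (forall r, 0 <= r -> 0 < Phi r) ->
  (forall r, is_derive u r (- (r * root (Phi (Rabs r))))) ->
  is_solution (S m) k alpha beta (sg * b) p_infty (fun r => sg * u r).
Proof.
  intros Hodd Hk Hkm Hbeta Hab Hb Hsg Hsa Phi root Hu Hu0 HP Hd.
  set (c := c_coef (S m) k) in *.
  assert (Hc : 0 < c) by (apply c_coef_pos; lia).
  assert (HkR : 0 < INR k) by (apply lt_0_INR; lia).
  assert (Hdp : forall r, 0 < r -> is_derive u r (- (r * root (Phi r)))).
  { intros r Hr. rewrite <- (Rabs_pos_eq r) at 3 by lra. apply Hd. }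
  assert (HT : forall T, profile_on m k alpha beta c b T u).
  { intros T. split; [exact Hu | split; [exact Hu0 |]].
    intros r Hr. split; [apply HP; lra | apply Hdp; lra]. }
  assert (HX : forall r, 0 <= r -> 0 < slope_excess m k alpha beta c u r).
  { intros r Hr.
    apply (slope_excess_pos m k alpha beta c b Hk Hc Hab Hb (r + 1) u);
      [apply HT | lra]. }
  pose (v1 := fun r => sg * - (r * root (Phi (Rabs r)))).
  assert (Hv : forall r, is_derive (fun r => sg * u r) r (v1 r)).
  { intros r. apply (is_derive_scal u r sg _ (Hd r)). }
  assert (HDv : forall r, Derive (fun r : R => sg * u r) r = v1 r).
  { intros r. now apply is_derive_unique. }
  assert (Hroot : forall x, 0 <= x -> continuous (fun y => root (Phi y)) x).
  { intros x Hx. apply continuous_root_flux; auto. }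
  assert (Hv1c : forall r, continuous v1 r).
  { intros r. apply continuous_Rmult; [apply continuous_const |].
    apply (continuous_opp (fun r => r * root (Phi (Rabs r)))).
    apply continuous_Rmult; [apply continuous_id |].
    apply (continuous_comp Rabs (fun y => root (Phi y))); [apply continuous_Rabs_all |].
    apply Hroot, Rabs_pos. }
  pose (v2 := fun r => - sg * (root (Phi r) *
    (1 + (slope_excess m k alpha beta c u r - INR (S m) * Phi r)
       * / (INR k * Phi r)))).
  assert (Hv2 : forall r, 0 < r -> is_derive v1 r (v2 r)).
  { intros r Hr. apply (is_derive_ext_loc (fun r => - sg * (r * root (Phi r)))).
    - apply locally_positive; trivial. intros y Hy. unfold v1.
      rewrite Rabs_pos_eq by lra.
      change (- sg * (y * root (Phi y)) = sg * - (y * root (Phi y))). ring.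
    - apply (is_derive_scal (fun r => r * root (Phi r))).
      apply is_derive_gradient; auto. apply HP. lra. }
  assert (Hv2c : forall r, 0 < r -> continuous v2 r).
  { intros r Hr. assert (HPr : 0 < Phi r) by (apply HP; lra).
    assert (HPc : forall x, continuous Phi x) by (intros x; now apply continuous_flux).
    apply continuous_Rmult; [apply continuous_const |].
    apply continuous_Rmult; [apply Hroot; lra |].
    apply continuous_Rplus; [apply continuous_const |].
    apply continuous_Rmult.
    - apply (continuous_minus (slope_excess m k alpha beta c u)
        (fun r => INR (S m) * Phi r)).
      + now apply continuous_slope_excess.
      + apply continuous_Rmult; [apply continuous_const | apply HPc].
    - apply (continuous_comp (fun r => INR k * Phi r) Rinv).
      + apply continuous_Rmult; [apply continuous_const | apply HPc].
      + apply continuous_Rinv. nra. }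
  split; [| split; [| split; [| split; [| split]]]].
  - exists v1. split.
    + intros x Hx. now apply is_derive_on_of_is_derive.
    + now apply continuous_on_forall.
  - exists v1. split.
    + intros x Hx. now apply is_derive_on_of_is_derive.
    + exists v2. split.
      * intros x Hx. apply is_derive_on_of_is_derive; trivial. apply Hv2, Hx.
      * apply continuous_on_forall. intros x Hx. apply Hv2c, Hx.
  - intros r [Hr _]. assert (H := HX r (Rlt_le _ _ Hr)). unfold slope_excess in H.
    assert (Hp : 0 < beta * r ^ 2 * kroot k c (Phi r)).
    { apply Rmult_lt_0_compat; [apply Rmult_lt_0_compat; trivial; now apply pow_lt |].
      apply kroot_pos. }
    fold Phi in H. destruct Hsg as [-> | ->]; nra.
  - intros r [Hr _]. unfold radial_lhs. fold c.
    rewrite (Derive_ext_loc _ (fun s : R => - sg * / c * (s ^ S m * Phi s))).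
    2:{ apply locally_positive; trivial. intros s Hs.
        rewrite HDv. unfold v1.
        rewrite Rabs_pos_eq by lra.
        assert (HR := kroot_pow k c (Phi s) Hk Hc (HP s ltac:(lra))).
        fold root in HR. rewrite <- HR at 2.
        replace (sg * - (s * root (Phi s))) with (- (sg * (s * root (Phi s)))) by ring.
        rewrite pow_odd_opp, !Rpow_mult_distr by trivial.
        replace (s ^ S m) with (s ^ (S m - k) * s ^ k)
          by (rewrite <- pow_add; f_equal; lia).
        rewrite (sign_pow_odd k sg) by trivial.
        field. lra. }
    assert (HD : Derive (fun s : R => - sg * / c * (s ^ S m * Phi s)) r
      = - sg * / c * (r ^ m * (alpha * u r + beta * r * - (r * root (Phi r))))).
    { apply is_derive_unique, (is_derive_scal (fun s => s ^ S m * Phi s)).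
      now apply is_derive_pow_flux; [| | apply Hdp]. }
    rewrite HD, HDv.
    unfold v1. rewrite Rabs_pos_eq by lra.
    assert (Hp := powerRZ_succ_cancel m r Hr).
    set (P := powerRZ r (1 - Z.of_nat (S m))) in *.
    change (c * P * (- sg * / c * (r ^ m *
      (alpha * u r + beta * r * - (r * root (Phi r))))) + alpha * (sg * u r)
      + beta * r * (sg * - (r * root (Phi r))) = 0).
    replace (c * P * (- sg * / c * (r ^ m *
      (alpha * u r + beta * r * - (r * root (Phi r))))))
      with (- sg * (P * r ^ m) * (alpha * u r + beta * r * - (r * root (Phi r))))
      by (field; lra).
    rewrite Hp. ring.
  - now rewrite Hu0.
  - apply is_derive_on_of_is_derive.
    + split; [apply Rle_refl | exact I].
    + evar_last; [apply Hv |]. unfold v1. ring.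
Qed.

Lemma is_derive_growth (v : R -> R) (delta r d : R) :
  0 < r -> 0 < v r -> is_derive v r d ->
  is_derive (fun r => r ^ 2 * Rpower (v r) (2 * delta)) r
    (2 * r * Rpower (v r) (2 * delta) / v r * (v r + delta * (r * d))).
Proof.
  intros Hr Hv Hd. unfold Rpower. auto_derive.
  - repeat split; trivial. now exists d.
  - assert (HD : Derive (fun x : R => v x) r = d) by now apply is_derive_unique.
    rewrite HD. field. lra.
Qed.

(** The even extension of sg w satisfies the first integral, hence is a profile,
    and profiles are unique. *)
Lemma solution_unique (m k : nat) (alpha beta a sg : R) (u w : R -> R) :
  Nat.Odd k -> (1 <= k)%nat -> (k <= S m)%nat ->
  alpha <= beta * (INR (S m) - 2 * INR k) / INR k -> 0 < alpha * (sg * a) ->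
  sg = 1 \/ sg = -1 ->
  (forall T, profile_on m k alpha beta (c_coef (S m) k) (sg * a) T u) ->
  is_solution (S m) k alpha beta a p_infty w ->
  forall r, 0 <= r -> w r = sg * u r.
Proof.
  intros Hodd Hk Hkm Hab Hb Hsg Hu Hw r Hr.
  assert (Hc : 0 < c_coef (S m) k) by (apply c_coef_pos; lia).
  destruct (solution_flow m k alpha beta a w Hk Hkm Hw) as [e [Hwc [Hec [He0 Hd]]]].
  assert (Hw0 : w 0 = a) by apply Hw.
  assert (Hsgk : sg ^ k = sg) by now apply sign_pow_odd.
  pose (W := fun s => sg * w (Rabs s)). pose (E := fun s => sg * e (Rabs s)).
  assert (HWc : forall x, continuous W x).
  { intros x. apply (continuous_Rmult (fun _ => sg)); [apply continuous_const | apply Hwc]. }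
  assert (HEc : forall x, continuous E x).
  { intros x. apply (continuous_Rmult (fun _ => sg)); [apply continuous_const | apply Hec]. }
  assert (HE0 : E 0 = 0) by (unfold E; rewrite Rabs_R0, He0; ring).
  assert (HW0 : W 0 = sg * a) by (unfold W; now rewrite Rabs_R0, Hw0).
  assert (HWE : forall s, 0 < s -> is_derive W s (E s)).
  { intros s Hs. unfold E. rewrite Rabs_pos_eq by lra.
    apply (is_derive_scal (fun s => w (Rabs s))).
    apply is_derive_comp_Rabs; trivial. now apply Hd. }
  assert (HEW : forall s, 0 < s ->
    is_derive (fun s => s ^ (S m - k) * E s ^ k) s
      (- / c_coef (S m) k * (s ^ m * (alpha * W s + beta * s * E s)))).
  { intros s Hs.
    apply (is_derive_ext_loc (fun s => sg * (s ^ (S m - k) * e s ^ k))).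
    - apply locally_positive; trivial. intros y Hy. unfold E.
      rewrite Rabs_pos_eq, Rpow_mult_distr, Hsgk by lra.
      change (sg * (y ^ (S m - k) * e y ^ k) = y ^ (S m - k) * (sg * e y ^ k)). ring.
    - evar_last.
      + apply (is_derive_scal (fun s => s ^ (S m - k) * e s ^ k) s sg _
          (proj2 (Hd s Hs))).
      + unfold W, E. rewrite Rabs_pos_eq by lra.
        change (sg * (- / c_coef (S m) k * (s ^ m * (alpha * w s + beta * s * e s)))
          = - / c_coef (S m) k
            * (s ^ m * (alpha * (sg * w s) + beta * s * (sg * e s)))).
        ring. }
  assert (HI := first_integral m k alpha beta _ W E Hk Hc HWc HEc HE0
    (fun s Hs => conj (HWE s Hs) (HEW s Hs))).
  assert (HWT : forall T, profile_on m k alpha beta (c_coef (S m) k) (sg * a) T W).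
  { apply gradient_is_profile with E; trivial. intros s Hs. apply HI. lra. }
  assert (HuW : u r = W r).
  { now apply (profile_unique m k alpha beta (c_coef (S m) k) (sg * a)). }
  rewrite HuW. unfold W. rewrite Rabs_pos_eq by trivial.
  destruct Hsg as [-> | ->]; ring.
Qed.

(** For alpha = 0, y = r^(n-k) w'^k has y' = - (beta / c) r^n w', so y y' is a
    nonpositive multiple of w'^(k+1), an even power; as y(0) = 0, y vanishes
    identically. *)
Lemma solution_constant (m k : nat) (beta a : R) (w : R -> R) :
  Nat.Odd k -> (1 <= k)%nat -> (k <= S m)%nat -> 0 < beta ->
  is_solution (S m) k 0 beta a p_infty w ->
  forall r, 0 <= r -> w r = a.
Proof.
  intros Hodd Hk Hkm Hbeta Hw r Hr.
  assert (Hc : 0 < c_coef (S m) k) by (apply c_coef_pos; lia).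
  destruct (solution_flow m k 0 beta a w Hk Hkm Hw) as [e [Hwc [Hec [He0 Hd]]]].
  assert (Hw0 : w 0 = a) by apply Hw.
  assert (Hc' := Rinv_0_lt_compat _ Hc).
  set (ci := / c_coef (S m) k) in *.
  pose (y := fun s => s ^ (S m - k) * e s ^ k).
  assert (Hy : forall s, 0 < s -> is_derive (fun s => - (y s * y s)) s
    (2 * ci * beta * s ^ S m * s ^ (S m - k) * e s ^ S k)).
  { intros s Hs. destruct (Hd s Hs) as [_ Hys].
    evar_last.
    - apply (is_derive_opp (fun s => y s * y s)).
      apply (is_derive_mult y y s _ _ Hys Hys). intros; apply Rmult_comm.
    - set (D := - ci * (s ^ m * (0 * w s + beta * s * e s))).
      change (- (D * y s + y s * D) =
        2 * ci * beta * s ^ S m * s ^ (S m - k) * e s ^ S k).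
      unfold D, y. simpl (s ^ S m). simpl (e s ^ S k). ring. }
  assert (Hsq : forall s, 0 < s -> y s = 0).
  { intros s Hs.
    assert (H : - (y (Rabs 0) * y (Rabs 0)) <= - (y (Rabs s) * y (Rabs s))).
    { apply (nondecreasing_of_derive (fun s => - (y (Rabs s) * y (Rabs s)))
        (fun s => 2 * ci * beta * s ^ S m * s ^ (S m - k) * e s ^ S k)); [lra | |].
      - intros z Hz. split.
        + apply (is_derive_comp_Rabs (fun s => - (y s * y s))); [lra |].
          apply Hy. lra.
        + apply Rmult_le_pos; [repeat apply Rmult_le_pos; try apply pow_le; lra |].
          destruct Hodd as [j ->]. replace (S (2 * j + 1)) with (2 * (j + 1))%nat by lia.
          rewrite pow_mult. apply pow_le, pow2_ge_0.
      - intros z _.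
        assert (Cy : continuous (fun s => y (Rabs s)) z).
        { apply (continuous_Rmult (fun s => Rabs s ^ (S m - k))
            (fun s => e (Rabs s) ^ k)).
          - apply (continuous_comp Rabs (fun s => s ^ (S m - k)));
              [apply continuous_Rabs_all | apply continuous_pow_all].
          - apply (continuous_comp (fun s => e (Rabs s)) (fun s => s ^ k));
              [apply Hec | apply continuous_pow_all]. }
        apply (continuous_opp (fun s => y (Rabs s) * y (Rabs s))).
        now apply continuous_Rmult. }
    assert (y (Rabs 0) = 0).
    { unfold y. rewrite Rabs_R0, He0, (pow_i k) by lia. ring. }
    rewrite (Rabs_pos_eq s) in H by lra. nra. }
  rewrite <- Hw0, <- (Rabs_pos_eq r) at 1 by trivial.
  transitivity (w (Rabs 0)); [| now rewrite Rabs_R0].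
  symmetry.
  apply (eq_of_derive (fun _ => w (Rabs 0)) (fun s => w (Rabs s)) (fun _ => 0));
    trivial.
  - intros x _. apply (is_derive_const (V := R_NormedModule)).
  - intros x Hx. apply is_derive_comp_Rabs; [lra |].
    evar_last; [now apply Hd |].
    assert (H := Hsq x (proj1 Hx)). unfold y in H.
    apply Rmult_integral in H. destruct H as [H | H].
    + exfalso. revert H. apply pow_nonzero. lra.
    + destruct (Req_dec (e x) 0) as [E | E]; [exact E |].
      exfalso. revert H. now apply pow_nonzero.
  - intros x _. apply continuous_const.
Qed.

Lemma constant_solution (m k : nat) (beta a : R) :
  (1 <= k)%nat -> 0 < a -> is_solution (S m) k 0 beta a p_infty (fun _ => a).
Proof.
  intros Hk Ha.
  assert (H : forall a x, is_derive (fun _ : R => a) x 0).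
  { intros a0 x. apply (is_derive_const (V := R_NormedModule)). }
  assert (H1 : forall D : R -> Prop, C1_on D (fun _ => 0)).
  { intros D. exists (fun _ => 0). split.
    - intros x Hx. now apply is_derive_on_of_is_derive.
    - apply continuous_on_forall. intros x _. apply continuous_const. }
  split; [| split; [| split; [| split; [| split]]]]; trivial.
  - exists (fun _ => 0). split.
    + intros x Hx. now apply is_derive_on_of_is_derive.
    + apply continuous_on_forall. intros x _. apply continuous_const.
  - exists (fun _ => 0). split; [| apply H1].
    intros x Hx. now apply is_derive_on_of_is_derive.
  - intros r _. unfold radial_lhs.
    rewrite (Derive_ext _ (fun _ => 0)).
    + rewrite !Derive_const. ring.
    + intros s. rewrite Derive_const, (pow_i k) by lia. apply Rmult_0_r.
  - apply is_derive_on_of_is_derive; trivial. split; [apply Rle_refl | exact I].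
Qed.

Theorem theorem1p1 (n k : nat) (a alpha beta : R)
    (Hn : (1 <= n)%nat) (Hkodd : Nat.Odd k) (Hk1 : (1 <= k)%nat)
    (Hkn : (k <= n)%nat) (Ha : 0 < a)
    (Hab : alpha <= beta * (INR n - 2 * INR k) / INR k)
    (Hbeta : 0 < beta) :
  exists v : R -> R,
    is_solution n k alpha beta a p_infty v /\
    (forall w : R -> R, is_solution n k alpha beta a p_infty w ->
       forall r : R, 0 <= r -> w r = v r) /\
    (alpha <> 0 ->
       let delta := beta / alpha in
       let E := fun r : R => r ^ 2 * Rpower (v r) (2 * delta) in
       forall r : R, 0 < r -> ex_derive E r /\ 0 < Derive E r).
Proof.
  destruct n as [| m]; [lia |].
  destruct (Req_dec alpha 0) as [-> | Hal].
  { exists (fun _ => a). split; [now apply constant_solution |].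
    split; [| now intros []].
    intros w Hw. now apply (solution_constant m k beta a w). }
  assert (Hc : 0 < c_coef (S m) k) by (apply c_coef_pos; lia).
  assert (Hsg : exists sg, (sg = 1 \/ sg = -1) /\ 0 < sg * alpha).
  { destruct (Rdichotomy _ _ Hal); [exists (-1) | exists 1]; split; auto; lra. }
  destruct Hsg as [sg [Hsg Hsa]].
  assert (Hb : 0 < alpha * (sg * a)).
  { replace (alpha * (sg * a)) with (sg * alpha * a) by ring.
    now apply Rmult_lt_0_compat. }
  destruct (profile_exists m k alpha beta (c_coef (S m) k) (sg * a)
    Hk1 Hc Hab Hb) as [u [Hu [Hu0 [HP Hd]]]].
  assert (Hsol := profile_solution m k alpha beta (sg * a) sg u Hkodd Hk1 Hkn
    Hbeta Hab Hb Hsg Hsa Hu Hu0 HP Hd).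
  replace (sg * (sg * a)) with a in Hsol by (destruct Hsg as [-> | ->]; ring).
  assert (Hdp : forall r, 0 < r -> is_derive u r
    (- (r * kroot k (c_coef (S m) k)
              (flux m (alpha - INR (S m) * beta) beta u r)))).
  { intros r Hr. rewrite <- (Rabs_pos_eq r) at 3 by lra. apply Hd. }
  assert (HT : forall T, profile_on m k alpha beta (c_coef (S m) k) (sg * a) T u).
  { intros T. split; [exact Hu | split; [exact Hu0 |]].
    intros r Hr. split; [apply HP; lra | apply Hdp; lra]. }
  exists (fun r => sg * u r). split; [exact Hsol | split].
  - intros w Hw. now apply (solution_unique m k alpha beta a sg u w).
  - intros _ delta E r Hr.
    assert (Hv : 0 < sg * u r) by (apply Hsol; now split).
    assert (HX := slope_excess_pos m k alpha beta (c_coef (S m) k) (sg * a)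
      Hk1 Hc Hab Hb (r + 1) u (HT _) r ltac:(lra)).
    assert (HE := is_derive_growth (fun r => sg * u r) delta r _ Hr Hv
      (is_derive_scal u r sg _ (Hdp r Hr))).
    split; [eexists; exact HE |].
    rewrite (is_derive_unique E r _ HE).
    apply Rmult_lt_0_compat.
    + apply Rdiv_lt_0_compat; [| exact Hv].
      apply Rmult_lt_0_compat; [lra | apply exp_pos].
    + unfold slope_excess in HX. set (p := kroot _ _ _) in *.
      change (0 < sg * u r + delta * (r * (sg * - (r * p)))).
      replace (sg * u r + delta * (r * (sg * - (r * p))))
        with (sg * / alpha * (alpha * u r - beta * r ^ 2 * p))
        by (unfold delta; field; trivial).
      apply Rmult_lt_0_compat; [| exact HX].
      replace (sg * / alpha) with (/ (sg * alpha)).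
      * now apply Rinv_0_lt_compat.
      * destruct Hsg as [-> | ->]; field; trivial.
Qed.
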